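(* For $0<q<1$, let $$\mathcal P_q(s)=\frac{1-q^2}{1-2q\cos s+q^2}=1+2\sum_{n\ge1}q^n\cos(ns).$$ If $m>0$, $0\le p\le1$, and $\alpha,\beta\in\mathbb T$, then the smooth positive density $$\rho(s)=m\bigl[p\,\mathcal P_q(s-\alpha)+(1-p)\mathcal P_q(s-\beta)\bigr]$$ satisfies $$2I_1+I_2>0.$$
   Context: $\mathbb T=\mathbb R/2\pi\mathbb Z$, $\rho_s$ is the derivative of $\rho$, and $\Lambda$ is the Fourier multiplier $\widehat{\Lambda f}(k)=|k|\hat f(k)$. For smooth $\rho$, $$I_1=\int_{\mathbb T}\rho(\Lambda\rho_s)\rho_s\,ds,\qquad I_2=\int_{\mathbb T}(\Lambda\rho)\rho_s^2\,ds.$$ *)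

(* Defs.v *)
From Stdlib Require Import Reals Lra Lia ZArith.
From Coquelicot Require Import Coquelicot.
Open Scope R_scope.

(* Functions on the circle R / 2 pi Z are represented by their 2 pi-periodic
   lifts to R. *)
Definition smooth_circle (f : R -> R) : Prop :=
  (forall s, f (s + 2 * PI) = f s) /\ (forall n s, ex_derive_n f n s).

Definition cis (x : R) : C := (cos x, sin x).

Definition fourier (f : R -> R) (k : Z) : C :=
  (RtoC (/ (2 * PI)) *
   RInt (V := C_R_CompleteNormedModule)
     (fun s => RtoC (f s) * cis (- (IZR k * s))) 0 (2 * PI))%C.

Definition Lambda_mode (f : R -> R) (k : Z) (s : R) : C :=
  (RtoC (IZR (Z.abs k)) * fourier f k * cis (IZR k * s))%C.

(* Fourier series with coefficients |k| * fourier f k, summed symmetrically;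
   the mode k = 0 vanishes, and for real f the modes k and -k are conjugate.
   The lemmas Lambda_continuous, Lambda_periodic and fourier_Lambda below show
   that for smooth f this is the continuous function on the circle whose k-th
   Fourier coefficient is |k| * fourier f k. *)
Definition Lambda (f : R -> R) (s : R) : R :=
  Series (fun n => Re (Lambda_mode f (Z.of_nat (S n)) s +
                       Lambda_mode f (- Z.of_nat (S n)) s)%C).

Definition I1 (rho : R -> R) : R :=
  RInt (fun s => rho s * Lambda (Derive rho) s * Derive rho s) 0 (2 * PI).

Definition I2 (rho : R -> R) : R :=
  RInt (fun s => Lambda rho s * (Derive rho s) ^ 2) 0 (2 * PI).

Definition poisson (q s : R) : R := (1 - q ^ 2) / (1 - 2 * q * cos s + q ^ 2).

Definition two_peak (q m p alpha beta s : R) : R :=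
  m * (p * poisson q (s - alpha) + (1 - p) * poisson q (s - beta)).

Lemma smooth_circle_Derive (f : R -> R) :
  smooth_circle f -> smooth_circle (Derive f).
Proof.
intros [Hp Hd]; split.
- intros s. rewrite <- (Derive_ext (fun t => f (t + 2 * PI)) f s Hp).
  unfold Derive. f_equal. apply Lim_ext. intros h.
  now replace (s + h + 2 * PI) with (s + 2 * PI + h) by ring.
- intros n s. destruct n as [|n]; [exact I|].
  specialize (Hd (S (S n)) s). simpl in Hd |- *.
  apply ex_derive_ext with (2 := Hd). intros t.
  clear Hd. revert t. induction n as [|n IH]; intros t; [reflexivity|].
  simpl. apply Derive_ext. exact IH.
Qed.

Lemma smooth_circle_ex_derive (f : R -> R) (s : R) :
  smooth_circle f -> ex_derive f s.
Proof. intros [_ H]. exact (H 1%nat s). Qed.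

Lemma smooth_circle_continuous (f : R -> R) (s : R) :
  smooth_circle f -> continuous f s.
Proof.
intros H. apply (ex_derive_continuous f s). now apply smooth_circle_ex_derive.
Qed.

Definition cos_coef (f : R -> R) (x : R) : R :=
  RInt (fun s => f s * cos (x * s)) 0 (2 * PI).
Definition sin_coef (f : R -> R) (x : R) : R :=
  RInt (fun s => f s * sin (x * s)) 0 (2 * PI).

Lemma continuous_cos_lin (x s : R) : continuous (fun t => cos (x * t)) s.
Proof. apply (ex_derive_continuous (fun t => cos (x * t)) s). auto_derive. exact I. Qed.

Lemma continuous_sin_lin (x s : R) : continuous (fun t => sin (x * t)) s.
Proof. apply (ex_derive_continuous (fun t => sin (x * t)) s). auto_derive. exact I. Qed.

Lemma ex_RInt_mult_continuous (f g : R -> R) (a b : R) :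
  (forall s, continuous f s) -> (forall s, continuous g s) ->
  ex_RInt (fun s => f s * g s) a b.
Proof.
intros Hf Hg. apply (ex_RInt_continuous (V := R_CompleteNormedModule)).
intros z _. apply (continuous_mult f g z); auto.
Qed.

Lemma fourier_coef (f : R -> R) (k : Z) : (forall s, continuous f s) ->
  fourier f k = (cos_coef f (IZR k) / (2 * PI), - sin_coef f (IZR k) / (2 * PI)).
Proof.
intros Hf. pose proof PI_RGT_0 as Hpi.
unfold fourier.
rewrite (is_RInt_unique (V := C_R_CompleteNormedModule) _ 0 (2 * PI)
          (cos_coef f (IZR k), - sin_coef f (IZR k))).
- unfold Cmult, RtoC; simpl. f_equal; field; lra.
- apply (is_RInt_fct_extend_pair (U := R_NormedModule) (V := R_NormedModule)).
  + apply (is_RInt_ext (fun s => f s * cos (IZR k * s))).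
    * intros x _. simpl. rewrite cos_neg. ring.
    * apply (RInt_correct (V := R_CompleteNormedModule)).
      apply ex_RInt_mult_continuous; auto. intros s; apply continuous_cos_lin.
  + apply (is_RInt_ext (fun s => opp (f s * sin (IZR k * s)))).
    * intros x _. simpl. rewrite sin_neg. unfold opp; simpl. ring.
    * apply (is_RInt_opp (V := R_NormedModule)).
      apply (RInt_correct (V := R_CompleteNormedModule)).
      apply ex_RInt_mult_continuous; auto. intros s; apply continuous_sin_lin.
Qed.

Lemma sin_2kPI (k : Z) : sin (IZR k * (2 * PI)) = 0.
Proof. apply sin_eq_0_1. exists (2 * k)%Z. rewrite mult_IZR. ring. Qed.

Lemma cos_2kPI (k : Z) : cos (IZR k * (2 * PI)) = 1.
Proof.
replace (IZR k * (2 * PI)) with (2 * (IZR k * PI)) by ring.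
rewrite cos_2a_sin.
assert (H : sin (IZR k * PI) = 0) by (apply sin_eq_0_1; now exists k).
rewrite H. ring.
Qed.

Lemma coef_Derive (f : R -> R) (k : Z) : smooth_circle f ->
  cos_coef (Derive f) (IZR k) = IZR k * sin_coef f (IZR k) /\
  sin_coef (Derive f) (IZR k) = - (IZR k * cos_coef f (IZR k)).
Proof.
intros Hf. pose proof (smooth_circle_Derive _ Hf) as Hf'.
assert (Hc : forall s, continuous f s) by (intros; now apply smooth_circle_continuous).
assert (Hc' : forall s, continuous (Derive f) s)
  by (intros; now apply smooth_circle_continuous).
assert (Hend : f (2 * PI) = f 0).
{ destruct Hf as [Hp _]. rewrite <- (Hp 0). f_equal; ring. }
set (x := IZR k).
assert (Hcx : forall s, continuous (fun t => cos (x * t)) s)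
  by (intros; apply continuous_cos_lin).
assert (Hsx : forall s, continuous (fun t => sin (x * t)) s)
  by (intros; apply continuous_sin_lin).
split.
- assert (H : is_RInt (fun t => Derive f t * cos (x * t) - x * (f t * sin (x * t)))
               0 (2 * PI) (f (2 * PI) * cos (x * (2 * PI)) - f 0 * cos (x * 0))).
  { apply (is_RInt_derive (fun t => f t * cos (x * t))).
    - intros t _. auto_derive; [now apply smooth_circle_ex_derive|].
      change (Derive (fun x0 => f x0) t) with (Derive f t). ring.
    - intros t _. apply (continuous_minus (V := R_NormedModule)
        (fun t => Derive f t * cos (x * t)) (fun t => x * (f t * sin (x * t)))).
      + apply (continuous_mult (Derive f) (fun t => cos (x * t))); auto.
      + apply (continuous_scal_r (V := R_NormedModule) x (fun t => f t * sin (x * t))).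
        apply (continuous_mult f (fun t => sin (x * t))); auto. }
  rewrite (cos_2kPI k : cos (x * (2 * PI)) = 1), Rmult_0_r, cos_0, Hend in H.
  assert (H2 : is_RInt (fun t => Derive f t * cos (x * t) - x * (f t * sin (x * t)))
               0 (2 * PI) (cos_coef (Derive f) x - x * sin_coef f x)).
  { apply (is_RInt_minus (V := R_NormedModule) (fun t => Derive f t * cos (x * t))
       (fun t => x * (f t * sin (x * t)))).
    - apply (RInt_correct (V := R_CompleteNormedModule)).
      apply ex_RInt_mult_continuous; auto.
    - apply (is_RInt_scal (V := R_NormedModule) (fun t => f t * sin (x * t))).
      apply (RInt_correct (V := R_CompleteNormedModule)).
      apply ex_RInt_mult_continuous; auto. }
  pose proof (is_RInt_unique _ _ _ _ H) as U1.
  pose proof (is_RInt_unique _ _ _ _ H2) as U2. lra.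
- assert (H : is_RInt (fun t => Derive f t * sin (x * t) + x * (f t * cos (x * t)))
               0 (2 * PI) (f (2 * PI) * sin (x * (2 * PI)) - f 0 * sin (x * 0))).
  { apply (is_RInt_derive (fun t => f t * sin (x * t))).
    - intros t _. auto_derive; [now apply smooth_circle_ex_derive|].
      change (Derive (fun x0 => f x0) t) with (Derive f t). ring.
    - intros t _. apply (continuous_plus (V := R_NormedModule)
        (fun t => Derive f t * sin (x * t)) (fun t => x * (f t * cos (x * t)))).
      + apply (continuous_mult (Derive f) (fun t => sin (x * t))); auto.
      + apply (continuous_scal_r (V := R_NormedModule) x (fun t => f t * cos (x * t))).
        apply (continuous_mult f (fun t => cos (x * t))); auto. }
  rewrite (sin_2kPI k : sin (x * (2 * PI)) = 0), !Rmult_0_r, sin_0 in H.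
  assert (H2 : is_RInt (fun t => Derive f t * sin (x * t) + x * (f t * cos (x * t)))
               0 (2 * PI) (sin_coef (Derive f) x + x * cos_coef f x)).
  { apply (is_RInt_plus (V := R_NormedModule) (fun t => Derive f t * sin (x * t))
       (fun t => x * (f t * cos (x * t)))).
    - apply (RInt_correct (V := R_CompleteNormedModule)).
      apply ex_RInt_mult_continuous; auto.
    - apply (is_RInt_scal (V := R_NormedModule) (fun t => f t * cos (x * t))).
      apply (RInt_correct (V := R_CompleteNormedModule)).
      apply ex_RInt_mult_continuous; auto. }
  pose proof (is_RInt_unique _ _ _ _ H) as U1.
  pose proof (is_RInt_unique _ _ _ _ H2) as U2. lra.
Qed.

Lemma coef_bound (f : R -> R) : (forall s, continuous f s) ->
  exists M, 0 <= M /\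
    forall x, Rabs (cos_coef f x) <= M /\ Rabs (sin_coef f x) <= M.
Proof.
intros Hf. pose proof PI_RGT_0 as Hpi.
assert (Hcr : forall g : R -> R, (forall s, continuous g s) -> (forall s, Rabs (g s) <= 1) ->
  Rabs (RInt (fun s => f s * g s) 0 (2 * PI)) <=
  RInt (fun s => Rabs (f s)) 0 (2 * PI)).
{ intros g Hg Hb.
  eapply Rle_trans;
    [apply abs_RInt_le; [lra|now apply ex_RInt_mult_continuous]|].
  apply RInt_le; [lra| | |].
  - apply (ex_RInt_continuous (V := R_CompleteNormedModule)). intros z _.
    apply continuous_comp; [apply (continuous_mult f g); auto|apply continuous_Rabs].
  - apply (ex_RInt_continuous (V := R_CompleteNormedModule)). intros z _.
    apply continuous_comp; [auto|apply continuous_Rabs].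
  - intros s _. rewrite Rabs_mult. rewrite <- (Rmult_1_r (Rabs (f s))) at 2.
    apply Rmult_le_compat_l; [apply Rabs_pos|auto]. }
exists (RInt (fun s => Rabs (f s)) 0 (2 * PI)). split.
- eapply Rle_trans; [apply Rabs_pos|apply (Hcr (fun _ => 0))].
  + intros s; apply continuous_const.
  + intros s; rewrite Rabs_R0; lra.
- intros x; split; apply Hcr; intros s.
  + apply continuous_cos_lin.
  + apply Rabs_le, COS_bound.
  + apply continuous_sin_lin.
  + apply Rabs_le, SIN_bound.
Qed.

Lemma coef_decay (f : R -> R) : smooth_circle f ->
  exists M, 0 <= M /\ forall n : nat,
    INR (S n) ^ 3 * Rabs (cos_coef f (INR (S n))) <= M /\
    INR (S n) ^ 3 * Rabs (sin_coef f (INR (S n))) <= M.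
Proof.
intros H0.
pose proof (smooth_circle_Derive _ H0) as H1.
pose proof (smooth_circle_Derive _ H1) as H2.
pose proof (smooth_circle_Derive _ H2) as H3.
destruct (coef_bound (Derive (Derive (Derive f)))) as [M [HM Hb]].
{ intros s; now apply smooth_circle_continuous. }
exists M; split; [exact HM|]. intros n.
specialize (Hb (IZR (Z.of_nat (S n)))).
destruct (coef_Derive _ (Z.of_nat (S n)) H0) as [A0 B0].
destruct (coef_Derive _ (Z.of_nat (S n)) H1) as [A1 B1].
destruct (coef_Derive _ (Z.of_nat (S n)) H2) as [A2 B2].
rewrite A2, B2, A1, B1, A0, B0 in Hb. rewrite <- INR_IZR_INZ in Hb.
assert (Hn : 0 <= INR (S n)) by apply pos_INR.
set (x := INR (S n)) in *.
rewrite <- (Rabs_pos_eq (x ^ 3)) by (now apply pow_le).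
rewrite <- !Rabs_mult.
destruct Hb as [Hb1 Hb2]. split.
- replace (x ^ 3 * cos_coef f x) with
    (- (x * (x * - (x * cos_coef f x)))) by ring. exact Hb2.
- replace (x ^ 3 * sin_coef f x) with
    (- (x * - (x * (x * sin_coef f x)))) by ring.
  rewrite Rabs_Ropp. exact Hb1.
Qed.

Definition Lambda_term (f : R -> R) (n : nat) (s : R) : R :=
  INR (S n) / PI * (cos_coef f (INR (S n)) * cos (INR (S n) * s) +
                    sin_coef f (INR (S n)) * sin (INR (S n) * s)).

Lemma coef_opp (f : R -> R) (x : R) : (forall s, continuous f s) ->
  cos_coef f (- x) = cos_coef f x /\ sin_coef f (- x) = - sin_coef f x.
Proof.
intros Hf. unfold cos_coef, sin_coef; split.
- apply RInt_ext. intros s _.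
  rewrite <- (cos_neg (x * s)). now replace (- x * s) with (- (x * s)) by ring.
- transitivity (opp (RInt (fun s => f s * sin (x * s)) 0 (2 * PI)));
    [|reflexivity].
  rewrite <- (RInt_opp (fun s => f s * sin (x * s))).
  + apply RInt_ext. intros s _. replace (- x * s) with (- (x * s)) by ring.
    rewrite sin_neg. unfold opp; simpl. ring.
  + apply ex_RInt_mult_continuous; auto. intros s; apply continuous_sin_lin.
Qed.

Lemma Lambda_eq (f : R -> R) (s : R) : (forall t, continuous f t) ->
  Lambda f s = Series (fun n => Lambda_term f n s).
Proof.
intros Hf. pose proof PI_RGT_0. unfold Lambda. apply Series_ext. intros n.
unfold Lambda_mode, Lambda_term. rewrite !fourier_coef by exact Hf.
rewrite Z.abs_opp, Z.abs_eq by lia. rewrite opp_IZR, <- INR_IZR_INZ.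
destruct (coef_opp f (INR (S n)) Hf) as [E1 E2]. rewrite E1, E2.
set (x := INR (S n)). unfold cis, Re, Cplus, Cmult, RtoC; cbn [fst snd].
replace (- x * s) with (- (x * s)) by ring. rewrite cos_neg, sin_neg.
field. lra.
Qed.

Lemma ex_series_inv_sq : ex_series (fun n => / INR (S n) ^ 2).
Proof.
assert (H : ex_series (fun n => / (INR (S n) * INR (S (S n))))).
{ exists 1.
  assert (Hs : forall m, sum_n (fun n => / (INR (S n) * INR (S (S n)))) m =
                 1 - / INR (S (S m))).
  { induction m as [|m IH].
    - rewrite sum_O. simpl. field.
    - rewrite sum_Sn, IH. change (plus ?a ?b) with (a + b).
      rewrite (S_INR (S (S m))), (S_INR (S m)).
      pose proof (pos_INR (S m)).
      apply Rminus_diag_uniq. field. lra. }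
  change (is_lim_seq (sum_n (fun n => / (INR (S n) * INR (S (S n))))) 1).
  apply (is_lim_seq_ext (fun m => 1 - / INR (S (S m)))); [now intros; rewrite Hs|].
  replace (Finite 1) with (Finite (1 - 0)) by (f_equal; ring).
  apply is_lim_seq_minus'; [apply is_lim_seq_const|].
  replace (Finite 0) with (Rbar_inv p_infty) by reflexivity.
  apply is_lim_seq_inv; [|discriminate].
  apply (is_lim_seq_incr_1 (fun n => INR (S n))), (is_lim_seq_incr_1 INR), is_lim_seq_INR. }
apply (ex_series_le (V := R_CompleteNormedModule) _
         (fun n => 2 * / (INR (S n) * INR (S (S n))))).
- intros n. change (norm ?x) with (Rabs x).
  assert (Hn : 1 <= INR (S n)) by (rewrite S_INR; pose proof (pos_INR n); lra).
  rewrite (S_INR (S n)). set (x := INR (S n)) in *.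
  rewrite Rabs_pos_eq by (left; apply Rinv_0_lt_compat; nra).
  replace (2 * / (x * (x + 1))) with (/ (x * (x + 1) / 2)) by (field; lra).
  apply Rinv_le_contravar; nra.
- apply (ex_series_scal (V := R_NormedModule) 2 _ H).
Qed.

Lemma Lambda_term_bound (f : R -> R) : smooth_circle f ->
  exists b : nat -> R, ex_series b /\ forall n s, Rabs (Lambda_term f n s) <= b n.
Proof.
intros Hf. destruct (coef_decay f Hf) as [M [HM Hd]]. pose proof PI_RGT_0 as Hpi.
exists (fun n => 2 * M / PI * / INR (S n) ^ 2). split.
- apply (ex_series_scal (V := R_NormedModule) (2 * M / PI) _ ex_series_inv_sq).
- intros n s. destruct (Hd n) as [Hc Hs]. unfold Lambda_term.
  assert (Hn : 1 <= INR (S n)) by (rewrite S_INR; pose proof (pos_INR n); lra).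
  set (x := INR (S n)) in *.
  assert (Hx3 : 0 < x ^ 3) by (apply pow_lt; lra).
  assert (Hx2 : 0 < x ^ 2) by (apply pow_lt; lra).
  assert (Hc1 : Rabs (cos (x * s)) <= 1) by apply Rabs_le, COS_bound.
  assert (Hs1 : Rabs (sin (x * s)) <= 1) by apply Rabs_le, SIN_bound.
  rewrite Rabs_mult, Rabs_pos_eq by (apply Rlt_le, Rdiv_lt_0_compat; lra).
  apply Rle_trans with (x / PI * (Rabs (cos_coef f x) + Rabs (sin_coef f x))).
  + apply Rmult_le_compat_l; [apply Rlt_le, Rdiv_lt_0_compat; lra|].
    eapply Rle_trans; [apply Rabs_triang|]. rewrite !Rabs_mult.
    pose proof (Rabs_pos (cos_coef f x)). pose proof (Rabs_pos (sin_coef f x)). nra.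
  + apply Rmult_le_reg_l with (x ^ 2 * PI); [nra|].
    replace (x ^ 2 * PI * (x / PI * (Rabs (cos_coef f x) + Rabs (sin_coef f x))))
      with (x ^ 3 * Rabs (cos_coef f x) + x ^ 3 * Rabs (sin_coef f x)) by (field; lra).
    replace (x ^ 2 * PI * (2 * M / PI * / x ^ 2)) with (2 * M) by (field; lra).
    lra.
Qed.

Definition Lambda_partial (f : R -> R) (m : nat) (s : R) : R :=
  sum_n (fun n => Lambda_term f n s) m.

Lemma Lambda_uniform (f : R -> R) (eps : posreal) : smooth_circle f ->
  eventually (fun m => forall s, Rabs (Lambda f s - Lambda_partial f m s) < eps).
Proof.
intros Hf. destruct (Lambda_term_bound f Hf) as [b [Hb Hle]].
assert (Hl : is_lim_seq (sum_n b) (Series b)) by exact (Series_correct _ Hb).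
apply is_lim_seq_spec in Hl. destruct (Hl eps) as [N HN]. exists N.
intros m Hm s. specialize (HN m Hm).
rewrite Lambda_eq by (intros; now apply smooth_circle_continuous).
assert (Hex : ex_series (fun n => Lambda_term f n s)).
{ apply (ex_series_le (V := R_CompleteNormedModule) _ b); auto. }
unfold Lambda_partial.
rewrite (Series_incr_n _ (S m)); [|lia|exact Hex].
rewrite (Series_incr_n b (S m)) in HN; [|lia|exact Hb].
rewrite sum_n_Reals in *. simpl pred in *.
match goal with |- Rabs (?A + ?B - ?A) < _ => replace (A + B - A) with B by ring end.
assert (Hex' : ex_series (fun k => b (S m + k)%nat)).
{ now apply (ex_series_incr_n b (S m)). }
eapply Rle_lt_trans.
- apply Series_Rabs.
  apply (ex_series_le (V := R_CompleteNormedModule) _ (fun k => b (S m + k)%nat)); auto.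
  intros n. change (norm ?x) with (Rabs x). rewrite Rabs_Rabsolu. apply Hle.
- eapply Rle_lt_trans.
  + apply Series_le with (2 := Hex'). intros n. split; [apply Rabs_pos|apply Hle].
  + apply Rabs_def2 in HN. lra.
Qed.

Lemma continuous_Lambda_partial (f : R -> R) (m : nat) (s : R) :
  continuous (Lambda_partial f m) s.
Proof.
assert (Ht : forall n, continuous (Lambda_term f n) s).
{ intros n. apply (ex_derive_continuous (Lambda_term f n) s).
  unfold Lambda_term. auto_derive. exact I. }
induction m as [|m IH].
- apply continuous_ext with (2 := Ht 0%nat). intros t.
  unfold Lambda_partial. now rewrite sum_O.
- apply (continuous_ext (fun t => plus (Lambda_partial f m t) (Lambda_term f (S m) t))).
  + intros t. unfold Lambda_partial. now rewrite sum_Sn.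
  + now apply (continuous_plus (V := R_NormedModule)).
Qed.

Lemma Lambda_continuous (f : R -> R) (s : R) :
  smooth_circle f -> continuous (Lambda f) s.
Proof.
intros Hf. apply continuity_pt_filterlim.
apply (CVU_continuity (Lambda_partial f) (Lambda f) s (mkposreal 1 Rlt_0_1)).
- intros e He. destruct (Lambda_uniform f (mkposreal e He) Hf) as [N HN].
  exists N. intros n y Hn _. apply (HN n Hn).
- intros n y _. apply continuity_pt_filterlim, continuous_Lambda_partial.
- apply Boule_center.
Qed.

Lemma Lambda_periodic (f : R -> R) (s : R) :
  smooth_circle f -> Lambda f (s + 2 * PI) = Lambda f s.
Proof.
intros Hf. rewrite !Lambda_eq by (intros; now apply smooth_circle_continuous).
apply Series_ext. intros n. unfold Lambda_term.
rewrite (Rmult_plus_distr_l _ s), cos_plus, sin_plus, INR_IZR_INZ, cos_2kPI, sin_2kPI.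
ring.
Qed.

Lemma RInt_cos_Z (k : Z) :
  is_RInt (fun s => cos (IZR k * s)) 0 (2 * PI) (if Z.eq_dec k 0 then 2 * PI else 0).
Proof.
destruct (Z.eq_dec k 0) as [->|Hk].
- apply (is_RInt_ext (fun _ => 1)); [intros; now rewrite Rmult_0_l, cos_0|].
  replace (2 * PI) with (scal (2 * PI - 0) 1) at 2
    by (unfold scal; simpl; unfold mult; simpl; ring).
  apply (is_RInt_const (V := R_NormedModule)).
- assert (Hk' : IZR k <> 0) by now apply not_0_IZR.
  replace 0 with (minus (sin (IZR k * (2 * PI)) / IZR k) (sin (IZR k * 0) / IZR k)) at 2.
  + apply (is_RInt_derive (fun s => sin (IZR k * s) / IZR k)).
    * intros t _. auto_derive; [exact I|]. now field.
    * intros t _. apply continuous_cos_lin.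
  + rewrite sin_2kPI, Rmult_0_r, sin_0. unfold minus, plus, opp; simpl. now field.
Qed.

Lemma RInt_sin_Z (k : Z) : is_RInt (fun s => sin (IZR k * s)) 0 (2 * PI) 0.
Proof.
destruct (Z.eq_dec k 0) as [->|Hk].
- apply (is_RInt_ext (fun _ => 0)); [intros; now rewrite Rmult_0_l, sin_0|].
  pose proof (is_RInt_const (V := R_NormedModule) 0 (2 * PI) 0) as H.
  rewrite (scal_zero_r (V := R_NormedModule)) in H. exact H.
- assert (Hk' : IZR k <> 0) by now apply not_0_IZR.
  replace 0 with (minus (- cos (IZR k * (2 * PI)) / IZR k) (- cos (IZR k * 0) / IZR k)) at 2.
  + apply (is_RInt_derive (fun s => - cos (IZR k * s) / IZR k)).
    * intros t _. auto_derive; [exact I|]. now field.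
    * intros t _. apply continuous_sin_lin.
  + rewrite cos_2kPI, Rmult_0_r, cos_0. unfold minus, plus, opp; simpl. now field.
Qed.

Definition delta (k : Z) : R := if Z.eq_dec k 0 then 2 * PI else 0.

Lemma is_RInt_comb2 (u v : R -> R) (a b c d U V : R) :
  is_RInt u a b U -> is_RInt v a b V ->
  is_RInt (fun s => c * u s + d * v s) a b (c * U + d * V).
Proof.
intros HU HV. apply (is_RInt_plus (V := R_NormedModule) (fun s => c * u s) (fun s => d * v s)).
- now apply (is_RInt_scal (V := R_NormedModule)).
- now apply (is_RInt_scal (V := R_NormedModule)).
Qed.

Lemma RInt_trig (n k : Z) :
  is_RInt (fun s => cos (IZR n * s) * cos (IZR k * s)) 0 (2 * PI)
    (/ 2 * delta (n - k) + / 2 * delta (n + k)) /\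
  is_RInt (fun s => sin (IZR n * s) * sin (IZR k * s)) 0 (2 * PI)
    (/ 2 * delta (n - k) + - / 2 * delta (n + k)) /\
  is_RInt (fun s => sin (IZR n * s) * cos (IZR k * s)) 0 (2 * PI) 0.
Proof.
assert (Em : forall s, IZR (n - k) * s = IZR n * s - IZR k * s)
  by (intros; rewrite minus_IZR; ring).
assert (Ep : forall s, IZR (n + k) * s = IZR n * s + IZR k * s)
  by (intros; rewrite plus_IZR; ring).
split; [|split].
- eapply is_RInt_ext; [|apply is_RInt_comb2; apply RInt_cos_Z].
  intros s _. cbv beta. rewrite Em, Ep, cos_minus, cos_plus. apply Rminus_diag_uniq. field.
- eapply is_RInt_ext; [|apply is_RInt_comb2; apply RInt_cos_Z].
  intros s _. cbv beta. rewrite Em, Ep, cos_minus, cos_plus. apply Rminus_diag_uniq. field.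
- replace 0 with (/ 2 * 0 + / 2 * 0) at 2 by ring.
  eapply is_RInt_ext; [|apply is_RInt_comb2; apply RInt_sin_Z].
  intros s _. cbv beta.
  instantiate (2 := (n + k)%Z). instantiate (1 := (n - k)%Z).
  rewrite Em, Ep, sin_minus, sin_plus. apply Rminus_diag_uniq. field.
Qed.

Definition hit (n j : nat) (v : R) : R := if Nat.eq_dec n j then v else 0.

Lemma Lambda_term_coef (f : R -> R) (n : nat) (k : Z) : (forall t, continuous f t) ->
  is_RInt (fun s => Lambda_term f n s * cos (IZR k * s)) 0 (2 * PI)
    (hit (S n) (Z.abs_nat k) (IZR (Z.abs k) * cos_coef f (IZR k))) /\
  is_RInt (fun s => Lambda_term f n s * sin (IZR k * s)) 0 (2 * PI)
    (hit (S n) (Z.abs_nat k) (IZR (Z.abs k) * sin_coef f (IZR k))).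
Proof.
intros Hf. pose proof PI_RGT_0 as Hpi.
destruct (coef_opp f (INR (S n)) Hf) as [Oc Os].
unfold Lambda_term. revert Oc Os. rewrite !INR_IZR_INZ.
set (z := Z.of_nat (S n)). intros Oc Os.
destruct (RInt_trig z k) as [Hcc [Hss Hsc]].
destruct (RInt_trig k z) as [_ [_ Hcs]].
set (x := IZR z) in *. set (A := cos_coef f x) in *. set (B := sin_coef f x) in *.
assert (Hd : (z = k /\ hit (S n) (Z.abs_nat k) = (fun v => v) /\ delta (z - k) = 2 * PI /\
              delta (z + k) = 0) \/
             (z = (- k)%Z /\ hit (S n) (Z.abs_nat k) = (fun v => v) /\ delta (z - k) = 0 /\
              delta (z + k) = 2 * PI) \/
             (hit (S n) (Z.abs_nat k) = (fun v => 0) /\ delta (z - k) = 0 /\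
              delta (z + k) = 0)).
{ unfold hit, delta. destruct (Z.eq_dec (z - k) 0), (Z.eq_dec (z + k) 0),
    (Nat.eq_dec (S n) (Z.abs_nat k)); unfold z in *; try lia.
  - left; repeat split; lia.
  - right; left; repeat split; lia.
  - right; right; repeat split. }
split.
- match goal with |- is_RInt _ _ _ ?v =>
    replace v with (x / PI * A * (/ 2 * delta (z - k) + / 2 * delta (z + k)) + x / PI * B * 0) end.
  + eapply is_RInt_ext; [|exact (is_RInt_comb2 _ _ _ _ _ _ _ _ Hcc Hsc)].
    intros s _. cbv beta. fold x. apply Rminus_diag_uniq. unfold Rdiv. ring.
  + destruct Hd as [[Ek [-> [-> ->]]]|[[Ek [-> [-> ->]]]|[-> [-> ->]]]].
    * rewrite <- Ek. fold x A. rewrite Z.abs_eq by (unfold z; lia). fold x. field; lra.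
    * replace k with (- z)%Z by lia. rewrite opp_IZR, Z.abs_opp, Z.abs_eq by (unfold z; lia).
      fold x. rewrite Oc. field; lra.
    * field; lra.
- match goal with |- is_RInt _ _ _ ?v =>
    replace v with (x / PI * B * (/ 2 * delta (z - k) + - / 2 * delta (z + k)) + x / PI * A * 0) end.
  + eapply is_RInt_ext; [|exact (is_RInt_comb2 _ _ _ _ _ _ _ _ Hss Hcs)].
    intros s _. cbv beta. fold x. apply Rminus_diag_uniq. unfold Rdiv. ring.
  + destruct Hd as [[Ek [-> [-> ->]]]|[[Ek [-> [-> ->]]]|[-> [-> ->]]]].
    * rewrite <- Ek. fold x B. rewrite Z.abs_eq by (unfold z; lia). fold x. field; lra.
    * replace k with (- z)%Z by lia. rewrite opp_IZR, Z.abs_opp, Z.abs_eq by (unfold z; lia).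
      fold x. rewrite Os. field; lra.
    * field; lra.
Qed.

Lemma is_RInt_sum_n (g : nat -> R -> R) (v : nat -> R) (e : R -> R) (a b : R) (m : nat) :
  (forall n, is_RInt (fun s => g n s * e s) a b (v n)) ->
  is_RInt (fun s => sum_n (fun n => g n s) m * e s) a b (sum_n v m).
Proof.
intros H. induction m as [|m IH].
- rewrite sum_O. apply is_RInt_ext with (2 := H 0%nat). intros s _. now rewrite sum_O.
- rewrite sum_Sn.
  apply is_RInt_ext with (2 := is_RInt_plus (V := R_NormedModule) _ _ _ _ _ _ IH (H (S m))).
  intros s _. rewrite sum_Sn. unfold plus; simpl. ring.
Qed.

Lemma sum_hit (j : nat) (v : R) (m : nat) : (j = 0%nat -> v = 0) -> (j <= S m)%nat ->
  sum_n (fun n => hit (S n) j v) m = v.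
Proof.
intros H0.
assert (Hgen : sum_n (fun n => hit (S n) j v) m = if le_dec j (S m) then v else 0).
{ unfold hit. induction m as [|m IH].
  - rewrite sum_O. destruct (Nat.eq_dec 1 j), (le_dec j 1); try lia; auto.
    rewrite H0; [reflexivity|lia].
  - rewrite sum_Sn, IH. change (plus ?a ?b) with (a + b).
    destruct (le_dec j (S m)), (Nat.eq_dec (S (S m)) j), (le_dec j (S (S m))); try lia; lra. }
intros Hj. rewrite Hgen. now destruct (le_dec j (S m)).
Qed.

Lemma Lambda_coef_limit (f e : R -> R) (v : R) (j : nat) : smooth_circle f ->
  (forall s, Rabs (e s) <= 1) -> (j = 0%nat -> v = 0) ->
  (forall n, is_RInt (fun s => Lambda_term f n s * e s) 0 (2 * PI) (hit (S n) j v)) ->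
  RInt (fun s => Lambda f s * e s) 0 (2 * PI) = v.
Proof.
intros Hf He H0 Ht.
destruct (filterlim_RInt (V := R_CompleteNormedModule)
  (fun m s => Lambda_partial f m s * e s) 0 (2 * PI) eventually _
  (fun s => Lambda f s * e s) (sum_n (fun n => hit (S n) j v))) as [If [H1 H2]].
- intros m. now apply (is_RInt_sum_n (Lambda_term f)).
- apply filterlim_locally. intros eps.
  destruct (Lambda_uniform f eps Hf) as [N HN]. exists N. intros m Hm s.
  specialize (HN m Hm s).
  change (Rabs (Lambda_partial f m s * e s - Lambda f s * e s) < eps).
  replace (Lambda_partial f m s * e s - Lambda f s * e s)
    with (- ((Lambda f s - Lambda_partial f m s) * e s)) by ring.
  rewrite Rabs_Ropp, Rabs_mult.
  eapply Rle_lt_trans; [|exact HN].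
  rewrite <- (Rmult_1_r (Rabs (Lambda f s - _))) at 2.
  apply Rmult_le_compat_l; [apply Rabs_pos|apply He].
- rewrite (is_RInt_unique _ _ _ _ H2).
  apply (filterlim_locally_unique (F := eventually) _ _ _ H1).
  apply filterlim_ext_loc with (fun _ : nat => v); [|apply filterlim_const].
  exists j. intros m Hm. symmetry. apply sum_hit; [exact H0|lia].
Qed.

Lemma fourier_Lambda (f : R -> R) (k : Z) : smooth_circle f ->
  fourier (Lambda f) k = (RtoC (IZR (Z.abs k)) * fourier f k)%C.
Proof.
intros Hf. pose proof PI_RGT_0 as Hpi.
assert (Hc : forall t, continuous f t) by (intros; now apply smooth_circle_continuous).
rewrite !fourier_coef; [|exact Hc|intros; now apply Lambda_continuous].
assert (H0 : Z.abs_nat k = 0%nat -> IZR (Z.abs k) = 0)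
  by (intros H; f_equal; lia).
assert (Ec : cos_coef (Lambda f) (IZR k) = IZR (Z.abs k) * cos_coef f (IZR k)).
{ apply (Lambda_coef_limit f (fun s => cos (IZR k * s))) with (j := Z.abs_nat k); auto.
  - intros; apply Rabs_le, COS_bound.
  - intros H; rewrite H0; auto; ring.
  - intros n; exact (proj1 (Lambda_term_coef f n k Hc)). }
assert (Es : sin_coef (Lambda f) (IZR k) = IZR (Z.abs k) * sin_coef f (IZR k)).
{ apply (Lambda_coef_limit f (fun s => sin (IZR k * s))) with (j := Z.abs_nat k); auto.
  - intros; apply Rabs_le, SIN_bound.
  - intros H; rewrite H0; auto; ring.
  - intros n; exact (proj2 (Lambda_term_coef f n k Hc)). }
rewrite Ec, Es. unfold Cmult, RtoC; simpl. f_equal; field; lra.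
Qed.

(* Main.v *)
Require Import Defs.
From Stdlib Require Import Reals Lra Lia List.
From Coquelicot Require Import Coquelicot.
Import ListNotations.
Open Scope R_scope.

(** Write [u = q e^(i(s - phi))] and [h = 1 / (1 - u)], the Szego kernel of the
    disc with its pole pushed outside.  The Poisson kernel is [2 Re h - 1], and
    the rotation derivation [D = -i d/ds] acts on [h] by [D h = h^2 - h].  Let
    [F], [G], [K] be the combinations of [2 h - 1], [D h = h^2 - h] and
    [D^2 h = 2 h^3 - 3 h^2 + h] over the two peaks with weights [p], [1 - p].
    Then [rho = m Re F], [rho' = -2 m Im G], and since [Lambda] is [D] on modes
    [e^(i n s)] with [n >= 0], [Lambda rho = 2 m Re G] and
    [Lambda rho' = -2 m Im K].

    The integrand [2 rho (Lambda rho') rho' + (Lambda rho) rho'^2] is then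
    [2 m^3] times the real part of
    [F G K~ + F K G~ - G K F~ + G G G~ - F G K - G G G] ([~] is conjugation).
    The last two terms have no negative modes and no mean.  The others have a
    single conjugated factor, and their means come from partial fractions:
    [h_a h_c~ = kappa (h_a + h_c~ - 1)] with
    [kappa = 1 / (1 - q^2 e^(i(c - a)))] turns a moment
    [h_a^i h_b^j h_c~^k] into smaller ones ([has_mean_moment]).  The outcome is
    that a triple of peaks [a], [b], [c] contributes a fixed cubic polynomial
    [cubic_kernel] in [kappa_ac] and [kappa_bc] ([two_peak_energy]).

    With two peaks, [kappa] takes the real value [k0 = 1 / (1 - q^2)] and two
    conjugate values [z], [z~].  Because [p + (1 - p) = 1], the real part of the
    weighted sum is [(1 - 4 t) A + t B] with [t = p (1 - p)] in [[0, 1/4]], where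
    [A > 0] is the single-peak value and [B] is, up to a factor, the value for
    two equal peaks.  So only [B > 0] is left.  Put [X = 2 k0 - 1 > 1] and
    [U + i Y = 2 z - 1]: as the separation of the peaks varies, [U + i Y] runs
    over the circle with diameter [[1/X, X]].  Writing
    [U = (1 + l y) / X] with [y = X^2 - 1] and [l] in [[0, 1]], the number
    [4 X^5 B] becomes a polynomial in [y] whose coefficients are polynomials in
    [l] that are nonnegative on [[0, 1]] ([equal_peaks_form_pos]). *)

(** * Means of complex functions over the circle *)

Lemma C_ext (z w : C) : fst z = fst w -> snd z = snd w -> z = w.
Proof. destruct z, w; simpl; intros; now f_equal. Qed.

Lemma Cconj_RtoC (r : R) : Cconj (RtoC r) = RtoC r.
Proof. apply C_ext; simpl; ring. Qed.

Definition Ccontinuous (f : R -> C) : Prop :=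
  (forall s, continuous (fun t => fst (f t)) s) /\
  (forall s, continuous (fun t => snd (f t)) s).

(** A relation rather than an integral-valued function, so that linearity
    needs no separate integrability hypotheses. *)
Definition has_mean (f : R -> C) (v : C) : Prop :=
  is_RInt (fun s => fst (f s)) 0 (2 * PI) (2 * PI * fst v) /\
  is_RInt (fun s => snd (f s)) 0 (2 * PI) (2 * PI * snd v).

Lemma Ccontinuous_ext (f g : R -> C) :
  (forall s, f s = g s) -> Ccontinuous f -> Ccontinuous g.
Proof.
intros H [A B]; split; intros s.
- apply (continuous_ext (fun t => fst (f t))); [intros; now rewrite H|apply A].
- apply (continuous_ext (fun t => snd (f t))); [intros; now rewrite H|apply B].
Qed.

Lemma Ccontinuous_const (c : C) : Ccontinuous (fun _ => c).
Proof. split; intros s; apply continuous_const. Qed.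

Lemma Ccontinuous_plus (f g : R -> C) :
  Ccontinuous f -> Ccontinuous g -> Ccontinuous (fun s => f s + g s)%C.
Proof.
intros [A B] [A' B']; split; intros s.
- apply (continuous_plus (V := R_NormedModule) (fun t => fst (f t)) (fun t => fst (g t))); auto.
- apply (continuous_plus (V := R_NormedModule) (fun t => snd (f t)) (fun t => snd (g t))); auto.
Qed.

Lemma Ccontinuous_mult (f g : R -> C) :
  Ccontinuous f -> Ccontinuous g -> Ccontinuous (fun s => f s * g s)%C.
Proof.
intros [A B] [A' B']; split; intros s; simpl.
- apply (continuous_minus (V := R_NormedModule)
    (fun t => fst (f t) * fst (g t)) (fun t => snd (f t) * snd (g t)));
    apply (continuous_mult (K := R_AbsRing)); auto.
- apply (continuous_plus (V := R_NormedModule)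
    (fun t => fst (f t) * snd (g t)) (fun t => snd (f t) * fst (g t)));
    apply (continuous_mult (K := R_AbsRing)); auto.
Qed.

Lemma Ccontinuous_pow (f : R -> C) (n : nat) : Ccontinuous f -> Ccontinuous (fun s => f s ^ n)%C.
Proof.
intros Hf; induction n as [|n IH]; simpl; [apply Ccontinuous_const|].
now apply Ccontinuous_mult.
Qed.

Lemma has_mean_ex (f : R -> C) : Ccontinuous f -> exists v, has_mean f v.
Proof.
intros [A B]. pose proof PI_RGT_0.
exists (RInt (fun s => fst (f s)) 0 (2 * PI) / (2 * PI),
        RInt (fun s => snd (f s)) 0 (2 * PI) / (2 * PI)).
assert (E : forall r : R, 2 * PI * (r / (2 * PI)) = r) by (intros; field; lra).
split; simpl; rewrite E;
  apply (RInt_correct (V := R_CompleteNormedModule));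
  apply (ex_RInt_continuous (V := R_CompleteNormedModule)); auto.
Qed.

Lemma has_mean_unique (f : R -> C) (v w : C) : has_mean f v -> has_mean f w -> v = w.
Proof.
intros [A B] [A' B']. pose proof PI_RGT_0.
apply C_ext; apply Rmult_eq_reg_l with (2 * PI); try lra.
- now rewrite <- (is_RInt_unique _ _ _ _ A), <- (is_RInt_unique _ _ _ _ A').
- now rewrite <- (is_RInt_unique _ _ _ _ B), <- (is_RInt_unique _ _ _ _ B').
Qed.

Lemma has_mean_ext (f g : R -> C) (v : C) :
  (forall s, f s = g s) -> has_mean f v -> has_mean g v.
Proof.
intros H [A B]; split.
- apply is_RInt_ext with (2 := A). intros s _; now rewrite H.
- apply is_RInt_ext with (2 := B). intros s _; now rewrite H.
Qed.

Lemma has_mean_comb (f g : R -> C) (c d v w : C) :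
  has_mean f v -> has_mean g w ->
  has_mean (fun s => c * f s + d * g s)%C (c * v + d * w)%C.
Proof.
intros [A B] [A' B']; split.
- replace (2 * PI * fst (c * v + d * w)%C) with
   ((1 * (fst c * (2 * PI * fst v) + - snd c * (2 * PI * snd v))) +
    (1 * (fst d * (2 * PI * fst w) + - snd d * (2 * PI * snd w)))) by (simpl; ring).
  eapply is_RInt_ext; [|apply is_RInt_comb2; apply is_RInt_comb2; eassumption].
  intros s _. simpl. ring.
- replace (2 * PI * snd (c * v + d * w)%C) with
   ((1 * (fst c * (2 * PI * snd v) + snd c * (2 * PI * fst v))) +
    (1 * (fst d * (2 * PI * snd w) + snd d * (2 * PI * fst w)))) by (simpl; ring).
  eapply is_RInt_ext; [|apply is_RInt_comb2; apply is_RInt_comb2; eassumption].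
  intros s _. simpl. ring.
Qed.

Lemma has_mean_scal (f : R -> C) (c v : C) :
  has_mean f v -> has_mean (fun s => c * f s)%C (c * v)%C.
Proof.
intros H. apply (has_mean_ext (fun s => c * f s + 0 * f s)%C); [intros; ring|].
replace (c * v)%C with (c * v + 0 * v)%C by ring. now apply has_mean_comb.
Qed.

Lemma has_mean_plus (f g : R -> C) (v w : C) :
  has_mean f v -> has_mean g w -> has_mean (fun s => f s + g s)%C (v + w)%C.
Proof.
intros H H'. apply (has_mean_ext (fun s => 1 * f s + 1 * g s)%C); [intros; ring|].
replace (v + w)%C with (1 * v + 1 * w)%C by ring. now apply has_mean_comb.
Qed.

Lemma has_mean_minus (f g : R -> C) (v w : C) :
  has_mean f v -> has_mean g w -> has_mean (fun s => f s - g s)%C (v - w)%C.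
Proof.
intros H H'. apply (has_mean_ext (fun s => 1 * f s + - (1) * g s)%C); [intros; ring|].
replace (v - w)%C with (1 * v + - (1) * w)%C by ring. now apply has_mean_comb.
Qed.

Lemma has_mean_conj (f : R -> C) (v : C) :
  has_mean f v -> has_mean (fun s => Cconj (f s)) (Cconj v).
Proof.
intros [A B]; split; simpl; [exact A|].
replace (2 * PI * - snd v) with (- (2 * PI * snd v)) by ring.
now apply (is_RInt_opp (V := R_NormedModule)).
Qed.

Lemma has_mean_const (c : C) : has_mean (fun _ => c) c.
Proof.
assert (H : forall r : R, is_RInt (fun _ => r) 0 (2 * PI) (2 * PI * r)).
{ intros r. pose proof (is_RInt_const (V := R_NormedModule) 0 (2 * PI) r) as H.
  unfold scal in H; simpl in H; unfold mult in H; simpl in H.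
  now rewrite Rminus_0_r in H. }
split; apply H.
Qed.

Lemma cis_plus (x y : R) : cis (x + y) = (cis x * cis y)%C.
Proof. unfold cis. rewrite cos_plus, sin_plus. apply C_ext; simpl; ring. Qed.

Lemma cis_0 : cis 0 = 1%C.
Proof. unfold cis. now rewrite cos_0, sin_0. Qed.

Lemma cis_conj (x : R) : Cconj (cis x) = cis (- x).
Proof. unfold cis, Cconj. simpl. now rewrite cos_neg, sin_neg. Qed.

Lemma cis_pow (s : R) (n : nat) : (cis s ^ n)%C = cis (INR n * s).
Proof.
induction n as [|n IH]; simpl Cpow.
- simpl. now rewrite Rmult_0_l, cis_0.
- rewrite IH, <- cis_plus. f_equal. rewrite S_INR. ring.
Qed.

Lemma Cmod_cis (s : R) : Cmod (cis s) = 1.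
Proof.
unfold Cmod, cis. simpl fst; simpl snd.
pose proof (sin2_cos2 s) as H. unfold Rsqr in H.
replace (cos s ^ 2 + sin s ^ 2) with 1 by (rewrite <- H; ring). apply sqrt_1.
Qed.

Lemma Ccontinuous_cis : Ccontinuous cis.
Proof.
split; intros s; simpl.
- apply (ex_derive_continuous cos). auto_derive. exact I.
- apply (ex_derive_continuous sin). auto_derive. exact I.
Qed.

Lemma has_mean_cis_pow (n : nat) : has_mean (fun s => cis s ^ S n)%C 0%C.
Proof.
apply (has_mean_ext (fun s => cis (IZR (Z.of_nat (S n)) * s))).
{ intros s. now rewrite cis_pow, INR_IZR_INZ. }
split; simpl fst; simpl snd; rewrite Rmult_0_r.
- pose proof (RInt_cos_Z (Z.of_nat (S n))) as H.
  destruct (Z.eq_dec (Z.of_nat (S n)) 0); [lia|exact H].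
- apply RInt_sin_Z.
Qed.

(** * The Szego kernel *)

Definition wave (q phi s : R) : C := (RtoC q * cis (s - phi))%C.

Definition szego (q phi s : R) : C := (/ (1 - wave q phi s))%C.

Lemma Cmod_wave (q phi s : R) : 0 <= q -> Cmod (wave q phi s) = q.
Proof.
intros Hq. unfold wave. rewrite Cmod_mult, Cmod_cis, Cmod_R, Rabs_pos_eq; lra.
Qed.

Lemma one_minus_neq_0 (z : C) : Cmod z < 1 -> (1 - z)%C <> 0%C.
Proof.
intros H E. replace z with (1 - (1 - z))%C in H by ring.
rewrite E in H. replace (1 - 0)%C with (RtoC 1) in H by ring. rewrite Cmod_1 in H. lra.
Qed.

Lemma szego_eq (q phi s : R) : 0 <= q < 1 ->
  ((1 - wave q phi s) * szego q phi s)%C = 1%C.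
Proof.
intros Hq. apply Cinv_r, one_minus_neq_0. rewrite Cmod_wave; lra.
Qed.

Lemma wave_split (q phi s : R) : wave q phi s = (RtoC q * cis (- phi) * cis s)%C.
Proof. unfold wave, Rminus. rewrite cis_plus. ring. Qed.

Lemma szego_den_pos (q t : R) : 0 <= q < 1 ->
  0 < (1 - q * cos t) ^ 2 + (q * sin t) ^ 2.
Proof.
intros Hq. pose proof (COS_bound t). pose proof (pow2_ge_0 (q * sin t)).
assert (0 < 1 - q * cos t) by nra. pose proof (pow_lt _ 2 H1). lra.
Qed.

Lemma szego_parts (q phi s : R) :
  szego q phi s =
  ((1 - q * cos (s - phi)) / ((1 - q * cos (s - phi)) ^ 2 + (q * sin (s - phi)) ^ 2),
   q * sin (s - phi) / ((1 - q * cos (s - phi)) ^ 2 + (q * sin (s - phi)) ^ 2)).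
Proof.
assert (E : (1 - wave q phi s)%C = (1 - q * cos (s - phi), - (q * sin (s - phi)))).
{ apply C_ext; simpl; ring. }
unfold szego. rewrite E. unfold Cinv. cbn [fst snd].
rewrite Ropp_involutive.
now replace ((- (q * sin (s - phi))) ^ 2) with ((q * sin (s - phi)) ^ 2) by ring.
Qed.

(** The real form of [h' = i (h^2 - h)], which makes real polynomials in the two
    parts of [h] stable under differentiation. *)
Lemma is_derive_szego (q phi s : R) : 0 <= q < 1 ->
  is_derive (fun t => fst (szego q phi t)) s
    (- snd (szego q phi s ^ 2 - szego q phi s)%C) /\
  is_derive (fun t => snd (szego q phi t)) s
    (fst (szego q phi s ^ 2 - szego q phi s)%C).
Proof.
intros Hq. pose proof (szego_den_pos q (s - phi) Hq) as Hd.
rewrite !szego_parts. split.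
- apply (is_derive_ext (fun t => (1 - q * cos (t - phi)) /
     ((1 - q * cos (t - phi)) ^ 2 + (q * sin (t - phi)) ^ 2))).
  { intros t. now rewrite szego_parts. }
  auto_derive; change (s + - phi) with (s - phi); [lra|].
  simpl. field. lra.
- apply (is_derive_ext (fun t => q * sin (t - phi) /
     ((1 - q * cos (t - phi)) ^ 2 + (q * sin (t - phi)) ^ 2))).
  { intros t. now rewrite szego_parts. }
  auto_derive; change (s + - phi) with (s - phi); [lra|].
  simpl. field. lra.
Qed.

Lemma Ccontinuous_szego (q phi : R) : 0 <= q < 1 -> Ccontinuous (szego q phi).
Proof.
intros Hq; split; intros s.
- apply (ex_derive_continuous (fun t => fst (szego q phi t)) s).
  eexists; exact (proj1 (is_derive_szego q phi s Hq)).
- apply (ex_derive_continuous (fun t => snd (szego q phi t)) s).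
  eexists; exact (proj2 (is_derive_szego q phi s Hq)).
Qed.

(** * Boundary values of holomorphic functions *)

(** The class of boundary values of holomorphic functions on the disc: the mean
    against [e^(i n s)] is the Fourier coefficient at [-n]. *)
Definition no_negative_modes (f : R -> C) : Prop :=
  Ccontinuous f /\ forall n, has_mean (fun s => f s * cis s ^ S n)%C 0%C.

Lemma Cmod_le_abs (z : C) (M : R) :
  Rabs (fst z) <= M -> Rabs (snd z) <= M -> Cmod z <= 2 * M.
Proof.
intros A B. destruct z as [x y]. simpl in A, B.
replace (x, y) with (RtoC x + Ci * RtoC y)%C
  by (apply C_ext; simpl; ring).
eapply Rle_trans; [apply Cmod_triangle|].
rewrite Cmod_mult, Cmod_Ci, !Cmod_R. lra.
Qed.

Lemma has_mean_modes_bounded (f : R -> C) : Ccontinuous f ->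
  exists M, forall n v, has_mean (fun s => f s * cis s ^ n)%C v -> Cmod v <= M.
Proof.
intros [A B]. pose proof PI_RGT_0 as Hpi.
destruct (coef_bound (fun s => fst (f s)) A) as [M1 [_ H1]].
destruct (coef_bound (fun s => snd (f s)) B) as [M2 [_ H2]].
exists (2 * ((M1 + M2) / (2 * PI))). intros n v [Hr Hi].
destruct (H1 (INR n)) as [Hc1 Hs1]. destruct (H2 (INR n)) as [Hc2 Hs2].
assert (Ic : forall g : R -> R, (forall s, continuous g s) ->
  is_RInt (fun s => g s * cos (INR n * s)) 0 (2 * PI) (cos_coef g (INR n))).
{ intros g Hg. apply (RInt_correct (V := R_CompleteNormedModule)).
  apply ex_RInt_mult_continuous; [exact Hg|]. intros; apply continuous_cos_lin. }
assert (Is : forall g : R -> R, (forall s, continuous g s) ->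
  is_RInt (fun s => g s * sin (INR n * s)) 0 (2 * PI) (sin_coef g (INR n))).
{ intros g Hg. apply (RInt_correct (V := R_CompleteNormedModule)).
  apply ex_RInt_mult_continuous; [exact Hg|]. intros; apply continuous_sin_lin. }
apply Cmod_le_abs; apply Rmult_le_reg_l with (2 * PI); try lra;
  rewrite <- (Rabs_pos_eq (2 * PI)) at 1 by lra; rewrite <- Rabs_mult;
  replace (2 * PI * ((M1 + M2) / (2 * PI))) with (M1 + M2) by (field; lra).
- assert (E : 2 * PI * fst v = 1 * cos_coef (fun s => fst (f s)) (INR n)
                               + (- (1)) * sin_coef (fun s => snd (f s)) (INR n)).
  { rewrite <- (is_RInt_unique _ _ _ _ Hr). apply is_RInt_unique.
    eapply is_RInt_ext; [|exact (is_RInt_comb2 _ _ _ _ _ _ _ _ (Ic _ A) (Is _ B))].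
    intros s _. rewrite cis_pow. unfold cis. simpl. ring. }
  rewrite E. eapply Rle_trans; [apply Rabs_triang|].
  rewrite !Rabs_mult, Rabs_Ropp, Rabs_R1. lra.
- assert (E : 2 * PI * snd v = 1 * sin_coef (fun s => fst (f s)) (INR n)
                               + 1 * cos_coef (fun s => snd (f s)) (INR n)).
  { rewrite <- (is_RInt_unique _ _ _ _ Hi). apply is_RInt_unique.
    eapply is_RInt_ext; [|exact (is_RInt_comb2 _ _ _ _ _ _ _ _ (Is _ A) (Ic _ B))].
    intros s _. rewrite cis_pow. unfold cis. simpl. ring. }
  rewrite E. eapply Rle_trans; [apply Rabs_triang|].
  rewrite !Rabs_mult, Rabs_R1. lra.
Qed.

Lemma Ccontinuous_modes (f : R -> C) (n : nat) :
  Ccontinuous f -> Ccontinuous (fun s => f s * cis s ^ n)%C.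
Proof. intros H. apply Ccontinuous_mult; [exact H|]. apply Ccontinuous_pow, Ccontinuous_cis. Qed.

(** Used to turn the recursion of coefficients in [szego_modes] into vanishing. *)
Lemma geometric_bound_zero (q M x : R) : 0 <= q < 1 ->
  (forall n : nat, Rabs x <= q ^ n * M) -> x = 0.
Proof.
intros Hq H.
assert (L : is_lim_seq (fun n => q ^ n * M) (0 * M)).
{ apply is_lim_seq_mult'; [|apply is_lim_seq_const].
  apply is_lim_seq_geom. rewrite Rabs_pos_eq; lra. }
pose proof (is_lim_seq_le _ _ _ _ H (is_lim_seq_const (Rabs x)) L) as K. simpl in K.
rewrite Rmult_0_l in K. pose proof (Rabs_pos x).
destruct (Req_dec x 0) as [|N]; [assumption|]. apply Rabs_pos_lt in N. lra.
Qed.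

(** Multiplication by [h = sum u^k] only adds nonnegative modes, and [u^0 = 1]
    alone reaches the mean.  Rather than summing the geometric series, the
    relation [h = 1 + w e^(is) h] gives [a_n = w a_(n+1)] for the coefficients
    [a_n] of [f h] with [n >= 1]; they are bounded and [|w| = q < 1], so they
    vanish. *)
Lemma szego_modes (q phi : R) (f : R -> C) : 0 <= q < 1 -> no_negative_modes f ->
  no_negative_modes (fun s => f s * szego q phi s)%C /\
  forall v, has_mean f v -> has_mean (fun s => f s * szego q phi s)%C v.
Proof.
intros Hq [Hf Hm].
set (w := (RtoC q * cis (- phi))%C).
assert (Hg : Ccontinuous (fun s => f s * szego q phi s)%C)
  by (apply Ccontinuous_mult; [exact Hf|now apply Ccontinuous_szego]).
(* [h = 1 + w e^(is) h], multiplied by [f e^(i n s)] *)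
assert (Hstep : forall n a b, has_mean (fun s => f s * cis s ^ n)%C a ->
  has_mean (fun s => f s * szego q phi s * cis s ^ S n)%C b ->
  has_mean (fun s => f s * szego q phi s * cis s ^ n)%C (a + w * b)%C).
{ intros n a b Ha Hb.
  apply (has_mean_ext (fun s => f s * cis s ^ n +
           w * (f s * szego q phi s * cis s ^ S n))%C).
  - intros s. pose proof (szego_eq q phi s Hq) as E.
    rewrite wave_split in E. fold w in E.
    transitivity (f s * cis s ^ n * ((1 - w * cis s) * szego q phi s)
      + w * (f s * szego q phi s * cis s ^ S n))%C; [rewrite E; ring|].
    simpl. ring.
  - apply has_mean_plus; [exact Ha|now apply has_mean_scal]. }
destruct (has_mean_modes_bounded _ Hg) as [M HM].
assert (Hw : Cmod w = q).
{ unfold w. rewrite Cmod_mult, Cmod_cis, Cmod_R, Rabs_pos_eq; lra. }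
assert (Hz : forall n, has_mean (fun s => f s * szego q phi s * cis s ^ S n)%C 0%C).
{ intros n. destruct (has_mean_ex _ (Ccontinuous_modes _ (S n) Hg)) as [v Hv].
  enough (v = 0%C) as <- by exact Hv.
  apply Cmod_eq_0. apply (geometric_bound_zero q M); [exact Hq|].
  intros k. rewrite Rabs_pos_eq by apply Cmod_ge_0.
  revert n v Hv. induction k as [|k IH]; intros n v Hv.
  - rewrite pow_O, Rmult_1_l. exact (HM _ _ Hv).
  - destruct (has_mean_ex _ (Ccontinuous_modes _ (S (S n)) Hg)) as [v' Hv'].
    rewrite (has_mean_unique _ _ _ Hv (Hstep _ _ _ (Hm n) Hv')).
    rewrite Cplus_0_l, Cmod_mult, Hw. simpl. rewrite Rmult_assoc.
    apply Rmult_le_compat_l; [lra|]. exact (IH _ _ Hv'). }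
split; [split; assumption|].
intros v Hv.
assert (Hv0 : has_mean (fun s => f s * cis s ^ 0)%C v)
  by (apply has_mean_ext with (2 := Hv); intros; simpl; ring).
pose proof (Hstep _ _ _ Hv0 (Hz 0%nat)) as H.
replace (v + w * 0)%C with v in H by ring.
apply has_mean_ext with (2 := H). intros; simpl; ring.
Qed.

Lemma szego_pow_modes (q phi : R) (f : R -> C) (i : nat) :
  0 <= q < 1 -> no_negative_modes f ->
  no_negative_modes (fun s => szego q phi s ^ i * f s)%C /\
  forall v, has_mean f v -> has_mean (fun s => szego q phi s ^ i * f s)%C v.
Proof.
intros Hq Hf. induction i as [|i [IH1 IH2]].
- split; [|intros v Hv; apply has_mean_ext with (2 := Hv); intros; simpl; ring].
  destruct Hf as [A B]. split.
  + apply Ccontinuous_ext with (2 := A). intros; simpl; ring.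
  + intros n. apply has_mean_ext with (2 := B n). intros; simpl; ring.
- destruct (szego_modes q phi _ Hq IH1) as [[A B] D]. split; [split|].
  + apply Ccontinuous_ext with (2 := A). intros; simpl; ring.
  + intros n. apply has_mean_ext with (2 := B n). intros; simpl; ring.
  + intros v Hv. apply has_mean_ext with (2 := D v (IH2 v Hv)). intros; simpl; ring.
Qed.

Lemma one_modes : no_negative_modes (fun _ => 1%C).
Proof.
split; [apply Ccontinuous_const|]. intros n.
apply has_mean_ext with (2 := has_mean_cis_pow n). intros; ring.
Qed.

(** * Moments with one conjugated pole *)

(** The Szego kernel of the pole at [a] continued to the point [q e^(i c)] inside
    the disc, as in the Cauchy formula. *)
Definition kappa (q a c : R) : C := (/ (1 - RtoC (q ^ 2) * cis (c - a)))%C.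

Lemma kappa_eq (q a c : R) : 0 <= q < 1 ->
  ((1 - RtoC (q ^ 2) * cis (c - a)) * kappa q a c)%C = 1%C.
Proof.
intros Hq. apply Cinv_r, one_minus_neq_0.
rewrite Cmod_mult, Cmod_cis, Cmod_R, Rabs_pos_eq by (apply pow2_ge_0). nra.
Qed.

(** Partial fractions: [u_a] times the conjugate of [u_c] does not depend on [s],
    so a product of two kernels on opposite sides of the circle separates. *)
Lemma szego_mul_conj (q a c s : R) : 0 <= q < 1 ->
  (szego q a s * Cconj (szego q c s))%C =
  (kappa q a c * (szego q a s + Cconj (szego q c s) - 1))%C.
Proof.
intros Hq.
pose proof (szego_eq q a s Hq) as Ha. pose proof (szego_eq q c s Hq) as Hc.
apply (f_equal Cconj) in Hc. rewrite Cmult_conj in Hc.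
rewrite Cconj_RtoC in Hc.
pose proof (kappa_eq q a c Hq) as Hk.
assert (E : (RtoC (q ^ 2) * cis (c - a))%C = (wave q a s * Cconj (wave q c s))%C).
{ unfold wave. rewrite Cmult_conj, cis_conj.
  replace (c - a) with ((s - a) + - (s - c)) by ring. rewrite cis_plus.
  replace (RtoC (q ^ 2)) with (RtoC q * RtoC q)%C by (apply C_ext; simpl; ring).
  rewrite Cconj_RtoC. ring. }
rewrite E in Hk.
replace (Cconj (1 - wave q c s)%C) with (1 - Cconj (wave q c s))%C in Hc
  by (apply C_ext; simpl; ring).
set (u := wave q a s) in *. set (v := Cconj (wave q c s)) in *.
set (h := szego q a s) in *. set (g := Cconj (szego q c s)) in *.
set (k := kappa q a c) in *.
(* [1 - u v = (1 - v) + (1 - u) - (1 - u) (1 - v)] *)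
transitivity (h * g * ((1 - u * v) * k))%C; [rewrite Hk; ring|].
transitivity (k * (((1 - v) * g) * h + ((1 - u) * h) * g - ((1 - u) * h) * ((1 - v) * g)))%C;
  [ring|]. rewrite Ha, Hc. ring.
Qed.

(** The mean of [h_c~^k h_a^i h_b^j] in terms of [x = kappa_ac] and
    [y = kappa_bc], by repeated use of [szego_mul_conj]: one pair [h_a h_c~] is
    removed while [i > 0], then one pair [h_b h_c~]. *)
Fixpoint moment (x y : C) (k : nat) {struct k} : nat -> nat -> C :=
  match k with
  | O => fun _ _ => 1%C
  | S k' =>
    fix mi (i : nat) : nat -> C :=
      match i with
      | S i' => fun j => (x * (moment x y k' i j + mi i' j - moment x y k' i' j))%C
      | O =>
        fix mj (j : nat) : C :=
          match j with
          | S j' => (y * (moment x y k' O j + mj j' - moment x y k' O j'))%C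
          | O => 1%C
          end
      end
  end.

Lemma has_mean_moment (q a b c : R) (k i j : nat) : 0 <= q < 1 ->
  has_mean (fun s => Cconj (szego q c s) ^ k * (szego q a s ^ i * szego q b s ^ j))%C
    (moment (kappa q a c) (kappa q b c) k i j).
Proof.
intros Hq. revert i j.
assert (Hhol : forall phi i f v, no_negative_modes f -> has_mean f v ->
   has_mean (fun s => szego q phi s ^ i * f s)%C v).
{ intros phi i f v Hf Hv. now apply (szego_pow_modes q phi f i Hq Hf). }
assert (H1 : forall phi i, has_mean (fun s => szego q phi s ^ i)%C 1%C).
{ intros phi i. apply has_mean_ext with (2 := Hhol phi i _ _ one_modes (has_mean_const 1%C)).
  intros; ring. }
induction k as [|k IHk].
- intros i j. change (moment (kappa q a c) (kappa q b c) 0 i j) with (RtoC 1).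
  apply (has_mean_ext (fun s => szego q a s ^ i * (szego q b s ^ j * 1))%C);
    [intros; simpl; ring|].
  apply Hhol.
  + apply (szego_pow_modes q b _ j Hq one_modes).
  + apply Hhol; [apply one_modes|apply has_mean_const].
- induction i as [|i IHi].
  + induction j as [|j IHj].
    * change (moment (kappa q a c) (kappa q b c) (S k) 0 0) with (RtoC 1).
      pose proof (has_mean_conj _ _ (H1 c (S k))) as H.
      rewrite Cconj_RtoC in H.
      apply has_mean_ext with (2 := H). intros s. rewrite Cpow_conj. simpl. ring.
    * change (moment (kappa q a c) (kappa q b c) (S k) 0 (S j)) with
        (kappa q b c * (moment (kappa q a c) (kappa q b c) k 0 (S j)
           + moment (kappa q a c) (kappa q b c) (S k) 0 j
           - moment (kappa q a c) (kappa q b c) k 0 j))%C.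
      eapply has_mean_ext; [|apply has_mean_scal, has_mean_minus;
        [apply has_mean_plus; [apply (IHk 0%nat (S j))|apply IHj]|apply (IHk 0%nat j)]].
      intros s. simpl.
      transitivity (Cconj (szego q c s) ^ k * szego q b s ^ j *
        (szego q b s * Cconj (szego q c s)))%C; [|ring].
      rewrite (szego_mul_conj q b c s Hq).
      ring.
  + intros j.
    change (moment (kappa q a c) (kappa q b c) (S k) (S i) j) with
        (kappa q a c * (moment (kappa q a c) (kappa q b c) k (S i) j
           + moment (kappa q a c) (kappa q b c) (S k) i j
           - moment (kappa q a c) (kappa q b c) k i j))%C.
    eapply has_mean_ext; [|apply has_mean_scal, has_mean_minus;
      [apply has_mean_plus; [apply (IHk (S i) j)|apply IHi]|apply (IHk i j)]].
    intros s. simpl.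
    transitivity (Cconj (szego q c s) ^ k * szego q a s ^ i * szego q b s ^ j *
        (szego q a s * Cconj (szego q c s)))%C; [|ring].
    rewrite (szego_mul_conj q a c s Hq). ring.
Qed.

(** * Triple products of polynomials in the kernels *)

Fixpoint poly_eval (l : list R) (z : C) : C :=
  match l with
  | [] => 0%C
  | c :: l' => (RtoC c + z * poly_eval l' z)%C
  end.

(** The linear functional that sends the monomial [z^n] to [F n], applied to
    [z^i] times the polynomial with coefficients [l]. *)
Fixpoint moment_sum (l : list R) (i : nat) (F : nat -> C) : C :=
  match l with
  | [] => 0%C
  | c :: l' => (RtoC c * F i + moment_sum l' (S i) F)%C
  end.

Lemma poly_eval_conj (l : list R) (z : C) : Cconj (poly_eval l z) = poly_eval l (Cconj z).
Proof.
induction l as [|c l IH]; simpl.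
- apply Cconj_RtoC.
- now rewrite Cplus_conj, Cmult_conj, Cconj_RtoC, IH.
Qed.

Lemma has_mean_poly_eval (l : list R) (i : nat) (z G : R -> C) (F : nat -> C) :
  (forall n, has_mean (fun s => z s ^ n * G s)%C (F n)) ->
  has_mean (fun s => z s ^ i * poly_eval l (z s) * G s)%C (moment_sum l i F).
Proof.
intros H. revert i. induction l as [|c l IH]; intros i.
- apply has_mean_ext with (2 := has_mean_const 0%C). intros; simpl; ring.
- simpl. eapply has_mean_ext;
    [|apply has_mean_plus; [apply has_mean_scal, (H i)|apply (IH (S i))]].
  intros s. simpl. ring.
Qed.

Definition triple_mean (l1 l2 l3 : list R) (x y : C) : C :=
  moment_sum l3 0 (fun k => moment_sum l1 0 (fun i => moment_sum l2 0 (fun j => moment x y k i j))).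

Lemma has_mean_triple_product (q a b c : R) (l1 l2 l3 : list R) : 0 <= q < 1 ->
  has_mean (fun s => poly_eval l1 (szego q a s) * poly_eval l2 (szego q b s) *
                     Cconj (poly_eval l3 (szego q c s)))%C
    (triple_mean l1 l2 l3 (kappa q a c) (kappa q b c)).
Proof.
intros Hq. unfold triple_mean.
eapply has_mean_ext; [|apply (has_mean_poly_eval l3 0 (fun s => Cconj (szego q c s))
  (fun s => poly_eval l1 (szego q a s) * poly_eval l2 (szego q b s))%C)].
- intros s. rewrite poly_eval_conj. simpl. ring.
- intros k. eapply has_mean_ext; [|apply (has_mean_poly_eval l1 0 (szego q a)
    (fun s => poly_eval l2 (szego q b s) * Cconj (szego q c s) ^ k)%C)].
  + intros s; simpl; ring.
  + intros i. eapply has_mean_ext; [|apply (has_mean_poly_eval l2 0 (szego q b)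
      (fun s => szego q a s ^ i * Cconj (szego q c s) ^ k)%C)].
    * intros s; simpl; ring.
    * intros j. eapply has_mean_ext; [|apply (has_mean_moment q a b c k i j Hq)].
      intros s; simpl; ring.
Qed.

(** The coefficients of [2 h - 1], [D h] and [D^2 h] as polynomials in [h]. *)
Definition polF : list R := [-1; 2].
Definition polG : list R := [0; -1; 1].
Definition polK : list R := [0; 1; -3; 2].

(** By the Cauchy formula, integrating against the conjugate of [D^n h_c]
    evaluates [D^n] of the holomorphic factor at [q e^(i c)], where [h_a] and
    [h_b] take the values [x = kappa_ac] and [y = kappa_bc].  With [f = h - 1/2]
    and primes for [D], the combination in
    [triple_mean_cubic_kernel] is [2 (f_a f_b')'' + 2 (f_a f_b'')' - 2 f_a' f_b''
    + (f_a' f_b')'], which expands to the three terms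
    [3 f_a'' f_b' + 5 f_a' f_b'' + 4 f_a f_b''']. *)
Definition cubic_kernel (x y : C) : C :=
  (3 * poly_eval polK x * poly_eval polG y + 5 * poly_eval polG x * poly_eval polK y
   + 2 * poly_eval polF x * (6 * y ^ 2 - 6 * y + 1) * poly_eval polG y)%C.

Lemma triple_mean_cubic_kernel (x y : C) :
  (triple_mean polF polG polK x y + triple_mean polF polK polG x y
   - triple_mean polG polK polF x y + triple_mean polG polG polG x y)%C = cubic_kernel x y.
Proof.
unfold triple_mean, cubic_kernel, polF, polG, polK. cbn [moment_sum poly_eval moment]. ring.
Qed.

Lemma no_negative_modes_comb (f g : R -> C) (c d : C) :
  no_negative_modes f -> no_negative_modes g ->
  no_negative_modes (fun s => c * f s + d * g s)%C.
Proof.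
intros [A B] [A' B']. split.
- apply Ccontinuous_plus; apply Ccontinuous_mult; auto using Ccontinuous_const.
- intros n. replace (RtoC 0) with (c * 0 + d * 0)%C by ring.
  apply has_mean_ext with (2 := has_mean_comb _ _ c d _ _ (B n) (B' n)).
  intros s; ring.
Qed.

Lemma no_negative_modes_ext (f g : R -> C) : (forall s, f s = g s) ->
  no_negative_modes f -> no_negative_modes g.
Proof.
intros H [A B]; split; [now apply (Ccontinuous_ext f)|].
intros n. apply has_mean_ext with (2 := B n). intros s; now rewrite H.
Qed.

(** The mean of a holomorphic function is its value at the centre, where
    [h = 1]. *)
Lemma poly_eval_modes (q phi : R) (l : list R) (f : R -> C) : 0 <= q < 1 ->
  no_negative_modes f ->
  no_negative_modes (fun s => f s * poly_eval l (szego q phi s))%C /\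
  forall v, has_mean f v ->
    has_mean (fun s => f s * poly_eval l (szego q phi s))%C (v * poly_eval l 1)%C.
Proof.
intros Hq. revert f. induction l as [|c l IH]; intros f Hf.
- split; [|intros v Hv].
  + apply no_negative_modes_ext with (2 := no_negative_modes_comb f f 0 0 Hf Hf).
    intros s; simpl; ring.
  + simpl. replace (v * 0)%C with (0 * v)%C by ring.
    apply has_mean_ext with (2 := has_mean_scal f 0 v Hv). intros s; simpl; ring.
- destruct (szego_modes q phi f Hq Hf) as [H1 H2].
  destruct (IH _ H1) as [H3 H4]. split; [|intros v Hv].
  + apply no_negative_modes_ext with (2 := no_negative_modes_comb _ _ (RtoC c) 1 Hf H3).
    intros s; simpl; ring.
  + replace (v * poly_eval (c :: l) 1)%C with (RtoC c * v + 1 * (v * poly_eval l 1))%C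
      by (simpl; ring).
    apply has_mean_ext with (2 := has_mean_comb _ _ (RtoC c) 1 _ _ Hv (H4 v (H2 v Hv))).
    intros s; simpl; ring.
Qed.

Definition peaks (q p alpha beta : R) (l : list R) (s : R) : C :=
  (RtoC p * poly_eval l (szego q alpha s) + RtoC (1 - p) * poly_eval l (szego q beta s))%C.

Lemma peaks_modes (q p alpha beta : R) (l : list R) (f : R -> C) : 0 <= q < 1 ->
  no_negative_modes f ->
  no_negative_modes (fun s => f s * peaks q p alpha beta l s)%C /\
  forall v, has_mean f v ->
    has_mean (fun s => f s * peaks q p alpha beta l s)%C (v * poly_eval l 1)%C.
Proof.
intros Hq Hf.
destruct (poly_eval_modes q alpha l f Hq Hf) as [A1 A2].
destruct (poly_eval_modes q beta l f Hq Hf) as [B1 B2]. split; [|intros v Hv].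
- apply no_negative_modes_ext with
    (2 := no_negative_modes_comb _ _ (RtoC p) (RtoC (1 - p)) A1 B1).
  intros s; unfold peaks; ring.
- replace (v * poly_eval l 1)%C with
    (RtoC p * (v * poly_eval l 1) + RtoC (1 - p) * (v * poly_eval l 1))%C
    by (apply C_ext; simpl; ring).
  apply has_mean_ext with
    (2 := has_mean_comb _ _ (RtoC p) (RtoC (1 - p)) _ _ (A2 v Hv) (B2 v Hv)).
  intros s; unfold peaks; ring.
Qed.

(** The factor [G], a combination of derivatives, vanishes at the centre of the
    disc. *)
Lemma has_mean_holomorphic (q p alpha beta : R) (l1 l2 : list R) : 0 <= q < 1 ->
  has_mean (fun s => peaks q p alpha beta l1 s * peaks q p alpha beta l2 s *
                     peaks q p alpha beta polG s)%C 0%C.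
Proof.
intros Hq.
destruct (peaks_modes q p alpha beta l1 _ Hq one_modes) as [H1 _].
destruct (peaks_modes q p alpha beta l2 _ Hq H1) as [H2 _].
destruct (has_mean_ex _ (proj1 H2)) as [v Hv].
pose proof (proj2 (peaks_modes q p alpha beta polG _ Hq H2) v Hv) as H.
replace (v * poly_eval polG 1)%C with (RtoC 0) in H by (simpl; ring).
apply has_mean_ext with (2 := H). intros s; ring.
Qed.

(** The trilinear sum over triples of peaks; [true] stands for the peak of weight
    [p]. *)
Definition peak_sum (p : R) (T : bool -> bool -> bool -> C) : C :=
  let w (i : bool) := RtoC (if i then p else 1 - p) in
  (w true * (w true * (w true * T true true true + w false * T true true false)
           + w false * (w true * T true false true + w false * T true false false))
   + w false * (w true * (w true * T false true true + w false * T false true false)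
           + w false * (w true * T false false true + w false * T false false false)))%C.

Lemma has_mean_peaks (q p alpha beta : R) (l1 l2 l3 : list R) : 0 <= q < 1 ->
  has_mean (fun s => peaks q p alpha beta l1 s * peaks q p alpha beta l2 s *
                     Cconj (peaks q p alpha beta l3 s))%C
   (peak_sum p (fun a b c =>
      let phi (i : bool) := if i then alpha else beta in
      triple_mean l1 l2 l3 (kappa q (phi a) (phi c)) (kappa q (phi b) (phi c)))).
Proof.
intros Hq. unfold peak_sum. cbv zeta.
pose proof (fun a b c => has_mean_triple_product q a b c l1 l2 l3 Hq) as H.
pose proof (fun f g v w => has_mean_comb f g (RtoC p) (RtoC (1 - p)) v w) as L.
eapply has_mean_ext; [|exact
  (L _ _ _ _
    (L _ _ _ _ (L _ _ _ _ (H alpha alpha alpha) (H alpha alpha beta))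
               (L _ _ _ _ (H alpha beta alpha) (H alpha beta beta)))
    (L _ _ _ _ (L _ _ _ _ (H beta alpha alpha) (H beta alpha beta))
               (L _ _ _ _ (H beta beta alpha) (H beta beta beta))))].
intros s. unfold peaks. rewrite Cplus_conj, !Cmult_conj.
rewrite !Cconj_RtoC. ring.
Qed.

(** * Smoothness and positivity of the density *)

(** A family of functions closed under differentiation, which gives derivatives
    of all orders without computing any of them. *)
Inductive szego_poly (q : R) : (R -> R) -> Prop :=
| szego_poly_const (c : R) : szego_poly q (fun _ => c)
| szego_poly_re (phi : R) : szego_poly q (fun s => fst (szego q phi s))
| szego_poly_im (phi : R) : szego_poly q (fun s => snd (szego q phi s))
| szego_poly_plus (f g : R -> R) :
    szego_poly q f -> szego_poly q g -> szego_poly q (fun s => f s + g s)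
| szego_poly_mult (f g : R -> R) :
    szego_poly q f -> szego_poly q g -> szego_poly q (fun s => f s * g s).

Lemma szego_poly_derive (q : R) (f : R -> R) : 0 <= q < 1 -> szego_poly q f ->
  exists f', szego_poly q f' /\ forall s, is_derive f s (f' s).
Proof.
intros Hq Hf.
induction Hf as [c|phi|phi|f g Hf [f' [Hf' Df]] Hg [g' [Hg' Dg]]
                         |f g Hf [f' [Hf' Df]] Hg [g' [Hg' Dg]]].
- exists (fun _ => 0). split; [constructor|]. intros s. apply (is_derive_const c s).
- exists (fun s => snd (szego q phi s) + -2 * (fst (szego q phi s) * snd (szego q phi s))).
  split; [repeat constructor|]. intros s.
  destruct (is_derive_szego q phi s Hq) as [D _].
  replace (_ + _) with (- snd (szego q phi s ^ 2 - szego q phi s)%C) by (simpl; ring).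
  exact D.
- exists (fun s => (fst (szego q phi s) * fst (szego q phi s)
     + -1 * (snd (szego q phi s) * snd (szego q phi s))) + -1 * fst (szego q phi s)).
  split; [repeat constructor|]. intros s.
  destruct (is_derive_szego q phi s Hq) as [_ D].
  replace (_ + _) with (fst (szego q phi s ^ 2 - szego q phi s)%C) by (simpl; ring).
  exact D.
- exists (fun s => f' s + g' s). split; [now constructor|].
  intros s. apply (is_derive_plus f g); auto.
- exists (fun s => f' s * g s + f s * g' s). split; [now repeat constructor|].
  intros s. apply (is_derive_mult f g); auto. intros; apply Rmult_comm.
Qed.

Lemma szego_poly_smooth (q : R) (f : R -> R) : 0 <= q < 1 -> szego_poly q f ->
  forall n s, ex_derive_n f n s.
Proof.
intros Hq Hf n s. destruct n as [|n]; [exact I|].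
assert (H : exists fn, szego_poly q fn /\ forall t, Derive_n f n t = fn t).
{ clear s. induction n as [|n [g [Hg Eg]]]; [now exists f|].
  destruct (szego_poly_derive q g Hq Hg) as [g' [Hg' Dg]].
  exists g'. split; [exact Hg'|]. intros t. simpl.
  rewrite (Derive_ext _ g t Eg). now apply is_derive_unique. }
destruct H as [g [Hg Eg]]. simpl.
destruct (szego_poly_derive q g Hq Hg) as [g' [_ Dg]].
apply (ex_derive_ext g); [intros; now rewrite Eg|]. eexists; apply Dg.
Qed.

Lemma poisson_szego (q phi s : R) : 0 <= q < 1 ->
  poisson q (s - phi) = 2 * fst (szego q phi s) - 1.
Proof.
intros Hq. pose proof (szego_den_pos q (s - phi) Hq) as Hd.
rewrite szego_parts. unfold poisson. cbn [fst].
assert (E : 1 - 2 * q * cos (s - phi) + q ^ 2 =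
   (1 - q * cos (s - phi)) ^ 2 + (q * sin (s - phi)) ^ 2).
{ pose proof (sin2_cos2 (s - phi)) as H. unfold Rsqr in H.
  replace (q ^ 2) with (q ^ 2 * (sin (s - phi) * sin (s - phi) +
    cos (s - phi) * cos (s - phi))) by (rewrite H; ring). ring. }
rewrite E. set (D := _ + (q * sin (s - phi)) ^ 2) in *.
replace (1 - q ^ 2) with (2 * (1 - q * cos (s - phi)) - D) by (rewrite <- E; ring).
field. lra.
Qed.

Lemma two_peak_peaks (q m p alpha beta s : R) : 0 <= q < 1 ->
  two_peak q m p alpha beta s = m * fst (peaks q p alpha beta polF s).
Proof.
intros Hq. unfold two_peak. rewrite !poisson_szego by exact Hq.
unfold peaks, polF. simpl. ring.
Qed.

Lemma two_peak_smooth (q m p alpha beta : R) : 0 <= q < 1 ->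
  smooth_circle (two_peak q m p alpha beta).
Proof.
intros Hq. split.
- intros s. unfold two_peak, poisson.
  replace (s + 2 * PI - alpha) with ((s - alpha) + 2 * PI) by ring.
  replace (s + 2 * PI - beta) with ((s - beta) + 2 * PI) by ring.
  rewrite !cos_plus, cos_2PI, sin_2PI, !Rmult_0_r, !Rminus_0_r, !Rmult_1_r.
  reflexivity.
- intros n s.
  apply (ex_derive_n_ext (fun t => m * (p * (2 * fst (szego q alpha t) + -1)
     + (1 - p) * (2 * fst (szego q beta t) + -1)))).
  + intros t. unfold two_peak. now rewrite !poisson_szego.
  + apply (szego_poly_smooth q); [exact Hq|]. repeat constructor.
Qed.

Lemma two_peak_derive (q m p alpha beta s : R) : 0 <= q < 1 ->
  Derive (two_peak q m p alpha beta) s = - 2 * m * snd (peaks q p alpha beta polG s).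
Proof.
intros Hq. apply is_derive_unique.
apply (is_derive_ext (fun t => m * (p * (2 * fst (szego q alpha t) - 1)
     + (1 - p) * (2 * fst (szego q beta t) - 1)))).
{ intros t. unfold two_peak. now rewrite !poisson_szego. }
destruct (is_derive_szego q alpha s Hq) as [Da _].
destruct (is_derive_szego q beta s Hq) as [Db _].
assert (H : forall (A B : R -> R) a b, is_derive A s a -> is_derive B s b ->
  is_derive (fun t => m * (p * (2 * A t - 1) + (1 - p) * (2 * B t - 1))) s
    (m * (p * (2 * a) + (1 - p) * (2 * b)))).
{ intros A B a b HA HB. auto_derive; [repeat split; eexists; eassumption|].
  rewrite (is_derive_unique (fun x : R => A x) _ _ HA), (is_derive_unique (fun x : R => B x) _ _ HB).
  ring. }
replace (- 2 * m * _) with (m * (p * (2 * - snd (szego q alpha s ^ 2 - szego q alpha s)%C)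
  + (1 - p) * (2 * - snd (szego q beta s ^ 2 - szego q beta s)%C))).
- apply (H _ _ _ _ Da Db).
- unfold peaks, polG. simpl. ring.
Qed.

Lemma poisson_pos (q s : R) : 0 <= q < 1 -> 0 < poisson q s.
Proof.
intros Hq. pose proof (COS_bound s). unfold poisson.
apply Rdiv_lt_0_compat; nra.
Qed.

(** * Power sums of the modes *)

Definition has_sum (a : nat -> C) (l : C) : Prop :=
  is_series (fun n => fst (a n)) (fst l) /\ is_series (fun n => snd (a n)) (snd l).

Lemma is_series_telescope (b : nat -> R) : is_lim_seq b 0 ->
  is_series (fun n => b n - b (S n)) (b 0%nat).
Proof.
intros H.
change (is_lim_seq (sum_n (fun n => b n - b (S n))) (b 0%nat)).
apply (is_lim_seq_ext (fun n => b 0%nat - b (S n))).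
- intros n. induction n as [|n IH]; [now rewrite sum_O|].
  rewrite sum_Sn, <- IH. unfold plus; simpl. ring.
- replace (Finite (b 0%nat)) with (Finite (b 0%nat - 0)) by (f_equal; ring).
  apply is_lim_seq_minus'; [apply is_lim_seq_const|].
  now apply (is_lim_seq_incr_1 b).
Qed.

Lemma has_sum_telescope (a b : nat -> C) (c : nat -> R) :
  (forall n, a n = (b n - b (S n))%C) -> (forall n, Cmod (b n) <= c n) ->
  is_lim_seq c 0 -> has_sum a (b 0%nat).
Proof.
intros Ha Hb Hc.
assert (L : forall r : nat -> R, (forall n, Rabs (r n) <= c n) -> is_lim_seq r 0).
{ intros r Hr. apply is_lim_seq_abs_0.
  apply is_lim_seq_le_le with (u := fun _ => 0) (w := c); [|apply is_lim_seq_const|exact Hc].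
  intros n; split; [apply Rabs_pos|apply Hr]. }
split; (eapply is_series_ext; [intros n; now rewrite Ha|]);
  [apply (is_series_telescope (fun n => fst (b n)))
  |apply (is_series_telescope (fun n => snd (b n)))];
  apply L; intros n; eapply Rle_trans; try apply (Hb n);
  (eapply Rle_trans; [|apply Rmax_Cmod]); [apply Rmax_l|apply Rmax_r].
Qed.

Lemma has_sum_ext (a b : nat -> C) (l : C) :
  (forall n, a n = b n) -> has_sum a l -> has_sum b l.
Proof.
intros H [A B]; split; eapply is_series_ext; try eassumption;
  intros n; cbv beta; now rewrite H.
Qed.

Lemma has_sum_comb (a b : nat -> C) (x y : R) (l k : C) :
  has_sum a l -> has_sum b k ->
  has_sum (fun n => RtoC x * a n + RtoC y * b n)%C (RtoC x * l + RtoC y * k)%C.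
Proof.
intros [A B] [A' B'].
assert (H : forall (r s : nat -> R) u v, is_series r u -> is_series s v ->
   is_series (fun n => x * r n + y * s n) (x * u + y * v)).
{ intros r s u v Hr Hs.
  apply (is_series_plus (V := R_NormedModule) (fun n => x * r n) (fun n => y * s n)).
  - now apply (is_series_scal (V := R_NormedModule) x r).
  - now apply (is_series_scal (V := R_NormedModule) y s). }
split.
- replace (fst _) with (x * fst l + y * fst k) by (simpl; ring).
  eapply is_series_ext; [|apply (H _ _ _ _ A A')]. intros n; simpl; ring.
- replace (snd _) with (x * snd l + y * snd k) by (simpl; ring).
  eapply is_series_ext; [|apply (H _ _ _ _ B B')]. intros n; simpl; ring.
Qed.

Lemma is_lim_seq_sq_geom (q : R) : 0 < q < 1 ->
  is_lim_seq (fun n => INR (S n) ^ 2 * q ^ S n) 0.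
Proof.
intros Hq. apply is_lim_seq_abs_0, ex_series_lim_0.
assert (Hp : forall n, 0 < INR (S n)) by (intros; apply lt_0_INR; lia).
apply ex_series_DAlembert with q; [lra| |].
- intros n. apply Rmult_integral_contrapositive_currified; apply pow_nonzero;
    [specialize (Hp n); lra|lra].
- apply (is_lim_seq_ext (fun n => (1 + / INR (S n)) * (1 + / INR (S n)) * q)).
  + intros n. rewrite Rabs_pos_eq.
    * rewrite (S_INR (S n)). specialize (Hp n). set (x := INR (S n)) in *.
      rewrite <- !tech_pow_Rmult. field. repeat split; try lra. apply pow_nonzero; lra.
    * left. apply Rdiv_lt_0_compat; apply Rmult_lt_0_compat; apply pow_lt; auto; lra.
  + assert (L : is_lim_seq (fun n => 1 + / INR (S n)) (1 + 0)).
    { apply is_lim_seq_plus'; [apply is_lim_seq_const|].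
      replace (Finite 0) with (Rbar_inv p_infty) by reflexivity.
      apply is_lim_seq_inv; [|discriminate].
      apply (is_lim_seq_incr_1 INR), is_lim_seq_INR. }
    replace (Finite q) with (Finite ((1 + 0) * (1 + 0) * q)) by (f_equal; ring).
    apply is_lim_seq_mult'; [now apply is_lim_seq_mult'|apply is_lim_seq_const].
Qed.

(** If [a n = P n - u P (S n)], the series of [u^(n+1) a n] telescopes; the
    quadratic bound on [P] makes the boundary term tend to [0]. *)
Lemma has_sum_wave (q phi s A : R) (P : nat -> C) (a : nat -> C) : 0 < q < 1 ->
  (forall n, Cmod (P n) <= INR (S n) ^ 2 * A) ->
  (forall n, (a n) = (P n - wave q phi s * P (S n))%C) ->
  has_sum (fun n => wave q phi s ^ S n * a n)%C (wave q phi s * P 0%nat)%C.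
Proof.
intros Hq HP Ha.
replace (wave q phi s * P 0%nat)%C with (wave q phi s ^ 1 * P 0%nat)%C by (simpl; ring).
apply (has_sum_telescope _ (fun n => wave q phi s ^ S n * P n)%C
  (fun n => A * (INR (S n) ^ 2 * q ^ S n))).
- intros n. rewrite Ha. simpl. ring.
- intros n. rewrite Cmod_mult, Cmod_pow, Cmod_wave by lra.
  rewrite (Rmult_comm (q ^ S n)), <- Rmult_assoc, (Rmult_comm A).
  apply Rmult_le_compat_r; [apply pow_le; lra|apply HP].
- replace (Finite 0) with (Finite (A * 0)) by (f_equal; ring).
  apply is_lim_seq_mult'; [apply is_lim_seq_const|now apply is_lim_seq_sq_geom].
Qed.

Lemma RtoC_S (n : nat) : RtoC (INR (S n)) = (RtoC (INR n) + 1)%C.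
Proof. rewrite S_INR. apply C_ext; simpl; ring. Qed.

(** The sums of [n^j u^n] over [n >= 1] are [D^j h] for [j > 0].  The functions
    [P] below are the tails [sum_(k >= 0) (N + k)^j u^k] in closed form, with
    [N = n + 1]. *)
Lemma wave_power_sums (q phi s : R) : 0 < q < 1 ->
  has_sum (fun n => wave q phi s ^ S n)%C (szego q phi s - 1)%C /\
  has_sum (fun n => RtoC (INR (S n)) * wave q phi s ^ S n)%C
    (poly_eval polG (szego q phi s)) /\
  has_sum (fun n => RtoC (INR (S n)) ^ 2 * wave q phi s ^ S n)%C
    (poly_eval polK (szego q phi s)).
Proof.
intros Hq. pose proof (szego_eq q phi s ltac:(lra)) as E.
set (u := wave q phi s) in *. set (h := szego q phi s) in *.
assert (Eu : (u * h = h - 1)%C).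
{ rewrite <- E. ring. }
assert (Hp : forall n, 1 <= INR (S n)) by (intros; rewrite S_INR; pose proof (pos_INR n); lra).
assert (Hp2 : forall n, INR (S n) <= INR (S n) ^ 2) by (intros n; specialize (Hp n); nra).
pose proof (Cmod_ge_0 h) as Ph. pose proof (Cmod_ge_0 (u * h)) as Pv.
split; [|split].
- replace (h - 1)%C with (u * h)%C by exact Eu.
  eapply has_sum_ext; [|apply (has_sum_wave q phi s (Cmod h) (fun _ => h) (fun _ => 1%C) Hq)].
  + intros n. cbv beta. fold u. ring.
  + intros n. specialize (Hp n). specialize (Hp2 n). nra.
  + intros n. fold u. rewrite <- E. ring.
- replace (poly_eval polG h) with (u * (h * (RtoC (INR 1) + u * h)))%C.
  2: { replace (u * (h * (INR 1 + u * h)))%C with ((u * h) * (INR 1 + u * h))%C by ring.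
       rewrite Eu. unfold polG. simpl. ring. }
  eapply has_sum_ext; [|apply (has_sum_wave q phi s (Cmod h * (1 + Cmod (u * h)))
    (fun n => h * (RtoC (INR (S n)) + u * h))%C (fun n => RtoC (INR (S n))) Hq)].
  + intros n. cbv beta. fold u. ring.
  + intros n. rewrite Cmod_mult, (Rmult_comm (_ ^ 2)), Rmult_assoc.
    apply Rmult_le_compat_l; [exact Ph|].
    eapply Rle_trans; [apply Cmod_triangle|]. rewrite Cmod_R, Rabs_pos_eq by apply pos_INR.
    specialize (Hp n). specialize (Hp2 n). nra.
  + intros n. fold u. rewrite (RtoC_S (S n)).
    transitivity (((1 - u) * h) * RtoC (INR (S n)) + u * h * ((1 - u) * h) - u * h)%C;
      [rewrite E; ring|ring].
- replace (poly_eval polK h) with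
    (u * (h * (RtoC (INR 1) ^ 2 + 2 * RtoC (INR 1) * (u * h) + (u * h) * (h + u * h))))%C.
  2: { match goal with |- (u * (h * ?z))%C = _ =>
         replace (u * (h * z))%C with ((u * h) * z)%C by ring end.
       rewrite Eu. unfold polK. simpl. ring. }
  eapply has_sum_ext; [|apply (has_sum_wave q phi s
    (Cmod h * (1 + 2 * Cmod (u * h) + Cmod (u * h * (h + u * h))))
    (fun n => h * (RtoC (INR (S n)) ^ 2 + 2 * RtoC (INR (S n)) * (u * h)
                   + (u * h) * (h + u * h)))%C
    (fun n => RtoC (INR (S n)) ^ 2)%C Hq)].
  + intros n. cbv beta. fold u. ring.
  + intros n. rewrite Cmod_mult, (Rmult_comm (_ ^ 2)), Rmult_assoc.
    apply Rmult_le_compat_l; [exact Ph|].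
    eapply Rle_trans; [apply Cmod_triangle|].
    eapply Rle_trans; [apply Rplus_le_compat_r, Cmod_triangle|].
    rewrite Cmod_pow, !(Cmod_mult (2 * _)), (Cmod_mult 2), !Cmod_R, (Rabs_pos_eq (INR _)) by apply pos_INR.
    rewrite (Rabs_pos_eq 2) by lra.
    pose proof (Cmod_ge_0 (u * h * (h + u * h))).
    specialize (Hp n). specialize (Hp2 n).
    assert (1 <= INR (S n) ^ 2) by lra. nra.
  + intros n. fold u. rewrite (RtoC_S (S n)). set (N := RtoC (INR (S n))).
    transitivity (((1 - u) * h) * N ^ 2 + 2 * N * (u * h) * ((1 - u) * h) - 2 * N * (u * h)
      + (u * h) * (h + u * h) * ((1 - u) * h) - u * h - 2 * (u * h) * (u * h))%C;
      [|ring].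
    rewrite E.
    transitivity (N ^ 2 + (u * h) * ((1 - u) * h) - u * h)%C; [rewrite E; ring|].
    ring.
Qed.

(** * Positivity of the cubic form *)

(** Sixteen times the real part of the weighted sum of [cubic_kernel] over the
    triples of peaks for [p = 1/2], in the coordinates [X = 2 k0 - 1] and
    [U + i Y = 2 z - 1], with [S = Y^2]. *)
Definition equal_peaks_form (X U S : R) : R :=
   5 * X ^ 5 - 8 * X ^ 3 + 3 * X
  + 5 * (U ^ 5 - 10 * U ^ 3 * S + 5 * U * S ^ 2) - 8 * (U ^ 3 - 3 * U * S) + 3 * U
  + X * (3 * (U ^ 4 - 6 * U ^ 2 * S + S ^ 2) - 4 * (U ^ 2 - S) + 1)
  + 2 * (U ^ 3 - 3 * U * S - U) * (X ^ 2 - 1)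
  + 2 * (U ^ 2 - S - 1) * X * (X ^ 2 - 1)
  + U * (3 * X ^ 4 - 4 * X ^ 2 + 1).

Lemma equal_peaks_form_expand (X l : R) : X <> 0 ->
  let y := X ^ 2 - 1 in let U := (1 + l * y) / X in
  X ^ 5 * equal_peaks_form X U ((X + / X) * U - 1 - U ^ 2) =
    y * (8 * l) + y ^ 2 * (16 - 52 * l + 80 * l ^ 2)
    + y ^ 3 * (24 + 18 * l - 174 * l ^ 2 + 216 * l ^ 3)
    + y ^ 4 * (18 + 4 * l + 22 * l ^ 2 - 200 * l ^ 3 + 224 * l ^ 4)
    + y ^ 5 * (5 + l + l ^ 2 + 9 * l ^ 3 - 76 * l ^ 4 + 80 * l ^ 5).
Proof. intros HX y U. unfold equal_peaks_form, U, y. field. exact HX. Qed.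

(** The coefficient of [y^2] has negative discriminant.  In the last three,
    splitting off squares times powers of [l], which vanish inside the interval
    where the coefficient is small, leaves a remainder that is nonnegative on
    [[0, 1]] by crude bounds. *)
Lemma expansion_pos (y l : R) : 0 < y -> 0 <= l <= 1 ->
  0 < y * (8 * l) + y ^ 2 * (16 - 52 * l + 80 * l ^ 2)
    + y ^ 3 * (24 + 18 * l - 174 * l ^ 2 + 216 * l ^ 3)
    + y ^ 4 * (18 + 4 * l + 22 * l ^ 2 - 200 * l ^ 3 + 224 * l ^ 4)
    + y ^ 5 * (5 + l + l ^ 2 + 9 * l ^ 3 - 76 * l ^ 4 + 80 * l ^ 5).
Proof.
intros Hy [Hl0 Hl1].
assert (H2 : 0 < 16 - 52 * l + 80 * l ^ 2) by nra.
assert (H3 : 0 <= 24 + 18 * l - 174 * l ^ 2 + 216 * l ^ 3).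
{ replace (24 + 18 * l - 174 * l ^ 2 + 216 * l ^ 3) with
   (216 * (l * (l - 2 / 5) ^ 2) + (24 - (6 / 5) * l ^ 2 - (414 / 25) * l)) by field.
  pose proof (Rmult_le_pos _ _ Hl0 (pow2_ge_0 (l - 2 / 5))). nra. }
assert (H4 : 0 <= 18 + 4 * l + 22 * l ^ 2 - 200 * l ^ 3 + 224 * l ^ 4).
{ replace (18 + 4 * l + 22 * l ^ 2 - 200 * l ^ 3 + 224 * l ^ 4) with
   (224 * (l * (l - / 2)) ^ 2 + 24 * (l * (l - 2 / 3) ^ 2)
    + (18 - 2 * l ^ 2 - (20 / 3) * l)) by field.
  pose proof (Rmult_le_pos _ _ Hl0 (pow2_ge_0 (l - 2 / 3))).
  pose proof (pow2_ge_0 (l * (l - / 2))). nra. }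
assert (H5 : 0 <= 5 + l + l ^ 2 + 9 * l ^ 3 - 76 * l ^ 4 + 80 * l ^ 5).
{ replace (5 + l + l ^ 2 + 9 * l ^ 3 - 76 * l ^ 4 + 80 * l ^ 5) with
   (80 * (l * (l * (l - / 2)) ^ 2) + (1 - l) * (5 + 6 * l + l ^ 2 * (7 - 4 * l)))
   by field.
  pose proof (Rmult_le_pos _ _ Hl0 (pow2_ge_0 (l * (l - / 2)))).
  pose proof (pow2_ge_0 l).
  assert (0 <= l ^ 2 * (7 - 4 * l)) by (apply Rmult_le_pos; lra).
  assert (0 <= (1 - l) * (5 + 6 * l + l ^ 2 * (7 - 4 * l))) by (apply Rmult_le_pos; lra).
  lra. }
pose proof (Rmult_lt_0_compat _ _ (pow_lt y 2 Hy) H2).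
pose proof (Rmult_le_pos _ _ (Rlt_le _ _ (pow_lt y 3 Hy)) H3).
pose proof (Rmult_le_pos _ _ (Rlt_le _ _ (pow_lt y 4 Hy)) H4).
pose proof (Rmult_le_pos _ _ (Rlt_le _ _ (pow_lt y 5 Hy)) H5).
assert (0 <= y * (8 * l)) by (apply Rmult_le_pos; lra).
lra.
Qed.

(** The equation for [S >= 0] says that [(U - 1/X) (X - U) >= 0], so [U] lies in
    [[1/X, X]] and can be parametrised by [l] in [[0, 1]]. *)
Lemma equal_peaks_form_pos (X U S : R) : 1 < X -> 0 <= S -> S = (X + / X) * U - 1 - U ^ 2 ->
  0 < equal_peaks_form X U S.
Proof.
intros HX HS ES.
assert (Hy : 0 < X ^ 2 - 1) by nra.
set (l := (X * U - 1) / (X ^ 2 - 1)).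
assert (EU : U = (1 + l * (X ^ 2 - 1)) / X) by (unfold l; field; lra).
assert (HS' : (X * U - 1) * (X * (X - U)) = X ^ 2 * S) by (rewrite ES; field; lra).
assert (Hprod : 0 <= (X * U - 1) * (X * (X - U))).
{ rewrite HS'. apply Rmult_le_pos; [apply pow2_ge_0|exact HS]. }
(* two factors of sum X^2 - 1 > 0 and nonnegative product are both nonnegative *)
assert (Hsum : (X * U - 1) + X * (X - U) = X ^ 2 - 1) by ring.
assert (Hl : 0 <= l <= 1).
{ assert (0 <= X * U - 1 /\ 0 <= X * (X - U)) as [A B] by (split; nra).
  unfold l; split.
  - apply Rmult_le_pos; [exact A|]. left; now apply Rinv_0_lt_compat.
  - apply Rmult_le_reg_r with (X ^ 2 - 1); [exact Hy|].
    unfold Rdiv. rewrite Rmult_assoc, Rinv_l; lra. }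
pose proof (equal_peaks_form_expand X l ltac:(lra)) as E. cbv zeta in E.
rewrite <- EU, <- ES in E.
pose proof (expansion_pos _ _ Hy Hl) as P. rewrite <- E in P.
apply Rmult_lt_reg_l with (X ^ 5); [apply pow_lt; lra|]. now rewrite Rmult_0_r.
Qed.

Lemma kappa_diag (q a : R) : 0 <= q < 1 -> kappa q a a = RtoC (/ (1 - q ^ 2)).
Proof.
intros Hq. unfold kappa. rewrite Rminus_diag, cis_0.
assert (1 - q ^ 2 <> 0) by nra.
rewrite RtoC_inv by assumption. f_equal. apply C_ext; simpl; ring.
Qed.

Lemma kappa_conj (q a c : R) : 0 <= q < 1 -> kappa q c a = Cconj (kappa q a c).
Proof.
intros Hq.
pose proof (kappa_eq q a c Hq) as H. apply (f_equal Cconj) in H.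
rewrite Cmult_conj in H.
replace (Cconj (1 - RtoC (q ^ 2) * cis (c - a))) with (1 - RtoC (q ^ 2) * cis (a - c))%C in H.
2: { rewrite Cminus_conj, Cmult_conj, cis_conj. replace (- (c - a)) with (a - c) by ring.
  f_equal; [|f_equal; f_equal]; apply C_ext; simpl; ring. }
rewrite Cconj_RtoC in H.
pose proof (kappa_eq q c a Hq) as H'.
transitivity (kappa q c a * ((1 - RtoC (q ^ 2) * cis (a - c)) * Cconj (kappa q a c)))%C;
  [rewrite H; ring|].
transitivity (((1 - RtoC (q ^ 2) * cis (a - c)) * kappa q c a) * Cconj (kappa q a c))%C;
  [ring|rewrite H'; ring].
Qed.

(** From [1 - 1/z = q^2 e^(i theta)], the point [z = kappa_ac] satisfies
    [|z - 1| = q^2 |z|], an Apollonius circle. *)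
Lemma kappa_circle (q a c : R) : 0 < q < 1 ->
  let X := (1 + q ^ 2) / (1 - q ^ 2) in
  let U := 2 * fst (kappa q a c) - 1 in
  let Y := 2 * snd (kappa q a c) in
  Y ^ 2 = (X + / X) * U - 1 - U ^ 2.
Proof.
intros Hq X U Y.
assert (Hx : 0 < q ^ 2 < 1) by nra.
pose proof (kappa_eq q a c ltac:(lra)) as H.
assert (E : (kappa q a c - 1)%C = (RtoC (q ^ 2) * cis (c - a) * kappa q a c)%C).
{ rewrite <- H. ring. }
apply (f_equal (fun z => Cmod z ^ 2)) in E. rewrite !Cmod_mult, Cmod_cis in E.
rewrite Cmod_R, Rabs_pos_eq, Rmult_1_r, Rpow_mult_distr in E by lra.
rewrite !Cmod2_alt in E.
unfold U, Y, X. set (x := q ^ 2) in *. destruct (kappa q a c) as [u v].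
simpl in E |- *.
assert (E2 : (1 - x ^ 2) * v ^ 2 = x ^ 2 * u ^ 2 - (u - 1) ^ 2) by (simpl; nra).
apply Rmult_eq_reg_l with ((1 - x ^ 2)); [|nra].
transitivity (4 * ((1 - x ^ 2) * v ^ 2)); [ring|]. rewrite E2.
field. lra.
Qed.

Lemma cubic_kernel_conj (x y : C) : Cconj (cubic_kernel x y) = cubic_kernel (Cconj x) (Cconj y).
Proof.
unfold cubic_kernel.
rewrite !Cplus_conj, !Cmult_conj, !poly_eval_conj, !Cplus_conj, Cminus_conj, !Cmult_conj, Cpow_conj.
now rewrite !Cconj_RtoC.
Qed.

(** The weights of the triples with three equal peaks add up to
    [p^3 + (1-p)^3 = 1 - 3 t] and those of each mixed pattern to [t], where
    [t = p (1 - p) <= 1/4].  Hence the sum is a convex combination of the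
    single-peak value and the value for [p = 1/2]. *)
Lemma peak_sum_cubic_kernel_pos (q p alpha beta : R) : 0 < q < 1 -> 0 <= p <= 1 ->
  0 < fst (peak_sum p (fun a b c =>
      let phi (i : bool) := if i then alpha else beta in
      cubic_kernel (kappa q (phi a) (phi c)) (kappa q (phi b) (phi c)))).
Proof.
intros Hq Hp. unfold peak_sum. cbv zeta beta iota.
assert (Hx : 0 < q ^ 2 < 1) by nra.
pose proof (kappa_circle q alpha beta Hq) as Hc. cbv zeta in Hc.
rewrite !kappa_diag by lra. rewrite (kappa_conj q alpha beta) by lra.
set (X := (1 + q ^ 2) / (1 - q ^ 2)) in *.
assert (HX : 1 < X).
{ unfold X. apply Rmult_lt_reg_r with (1 - q ^ 2); [lra|].
  unfold Rdiv. rewrite Rmult_assoc, Rinv_l; lra. }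
assert (Hk : / (1 - q ^ 2) = (1 + X) / 2) by (unfold X; field; lra).
rewrite Hk. set (k0 := RtoC ((1 + X) / 2)).
assert (Ek0 : k0 = Cconj k0) by (apply C_ext; simpl; ring).
set (z := kappa q alpha beta) in *.
assert (E1 : cubic_kernel (Cconj z) k0 = Cconj (cubic_kernel z k0))
  by (rewrite Ek0 at 1; now rewrite cubic_kernel_conj).
assert (E2 : cubic_kernel k0 (Cconj z) = Cconj (cubic_kernel k0 z))
  by (rewrite Ek0 at 1; now rewrite cubic_kernel_conj).
rewrite E1, E2, <- cubic_kernel_conj.
assert (F0 : fst (cubic_kernel k0 k0) = X * (X ^ 2 - 1) * (5 * X ^ 2 - 3) / 4).
{ unfold k0, cubic_kernel, polF, polG, polK. simpl. field. }
set (S := (2 * snd z) ^ 2) in *. set (U := 2 * fst z - 1) in *.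
assert (FB : fst (cubic_kernel k0 k0) + fst (cubic_kernel k0 z) + fst (cubic_kernel z k0)
  + fst (cubic_kernel z z)
             = equal_peaks_form X U S / 4).
{ rewrite F0. unfold k0, S, U, cubic_kernel, polF, polG, polK, equal_peaks_form.
  destruct z as [u v]. simpl. field. }
assert (HV : 0 < equal_peaks_form X U S) 
  by (apply equal_peaks_form_pos; [exact HX|apply pow2_ge_0|exact Hc]).
assert (H0 : 0 < fst (cubic_kernel k0 k0)).
{ rewrite F0. assert (1 < X ^ 2) by nra.
  apply Rdiv_lt_0_compat; [|lra]. repeat apply Rmult_lt_0_compat; lra. }
set (t := p * (1 - p)).
assert (Ht : 0 <= t <= / 4) by (pose proof (pow2_ge_0 (p - / 2)); unfold t; split; nra).
replace (fst _) with ((1 - 4 * t) * fst (cubic_kernel k0 k0) +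
  t * (fst (cubic_kernel k0 k0) + fst (cubic_kernel k0 z) + fst (cubic_kernel z k0)
  + fst (cubic_kernel z z))).
- rewrite FB. destruct (Req_dec t 0) as [->|Ht0]; [lra|].
  assert (0 <= (1 - 4 * t) * fst (cubic_kernel k0 k0)) by (apply Rmult_le_pos; lra).
  assert (0 < t * (equal_peaks_form X U S / 4)) by (apply Rmult_lt_0_compat; lra).
  lra.
- unfold t. destruct (cubic_kernel k0 k0), (cubic_kernel k0 z), (cubic_kernel z k0), (cubic_kernel z z).
  simpl. ring.
Qed.

(** * Fourier coefficients of the density and of its images *)

Lemma szego_fourier (q phi : R) (n : nat) : 0 <= q < 1 ->
  has_mean (fun s => szego q phi s * Cconj (cis s) ^ n)%C ((RtoC q * cis (- phi)) ^ n)%C.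
Proof.
intros Hq. induction n as [|n IH].
- destruct (szego_modes q phi _ Hq one_modes) as [_ H].
  apply has_mean_ext with (2 := H _ (has_mean_const 1%C)). intros; simpl; ring.
- replace ((RtoC q * cis (- phi)) ^ S n)%C with
    (Cconj 0 + RtoC q * cis (- phi) * (RtoC q * cis (- phi)) ^ n)%C
    by (simpl; rewrite Cconj_RtoC; ring).
  apply has_mean_ext with (2 := has_mean_plus _ _ _ _
    (has_mean_conj _ _ (has_mean_cis_pow n)) (has_mean_scal _ _ _ IH)).
  intros s. rewrite Cpow_conj.
  pose proof (szego_eq q phi s Hq) as E. rewrite wave_split in E.
  assert (U : (cis s * Cconj (cis s))%C = 1%C).
  { rewrite cis_conj, <- cis_plus, Rplus_opp_r. apply cis_0. }
  set (w := (RtoC q * cis (- phi))%C) in *. set (e := cis s) in *.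
  set (h := szego q phi s) in *. simpl.
  transitivity (((1 - w * e) * h) * (Cconj e * Cconj e ^ n) +
     w * (h * Cconj e ^ n) * (e * Cconj e))%C; [rewrite E, U; ring|ring].
Qed.

(** The mean of the density against [e^(i n s)] for [n >= 1], that is, its
    Fourier coefficient at [-n]. *)
Definition two_peak_mode (q m p alpha beta : R) (n : nat) : C :=
  (RtoC m * (RtoC p * (RtoC q * cis alpha) ^ n +
             RtoC (1 - p) * (RtoC q * cis beta) ^ n))%C.

Lemma two_peak_has_mode (q m p alpha beta : R) (n : nat) : 0 <= q < 1 ->
  has_mean (fun s => RtoC (two_peak q m p alpha beta s) * cis s ^ S n)%C
    (two_peak_mode q m p alpha beta (S n)).
Proof.
intros Hq.
assert (H : forall phi, has_mean (fun s => RtoC (2 * fst (szego q phi s) - 1) * cis s ^ S n)%C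
   ((RtoC q * cis phi) ^ S n)%C).
{ intros phi.
  destruct (szego_modes q phi _ Hq one_modes) as [[_ H0] _].
  pose proof (has_mean_conj _ _ (szego_fourier q phi (S n) Hq)) as H1.
  pose proof (has_mean_cis_pow n) as H2.
  replace ((RtoC q * cis phi) ^ S n)%C with
    (0 + Cconj ((RtoC q * cis (- phi)) ^ S n) - 0)%C.
  2: { rewrite Cpow_conj, Cmult_conj, cis_conj, Ropp_involutive.
       rewrite Cconj_RtoC. ring. }
  apply has_mean_ext with (2 := has_mean_minus _ _ _ _
    (has_mean_plus _ _ _ _ (H0 n) H1) H2).
  intros s. rewrite Cmult_conj, Cpow_conj, Cconj_conj.
  replace (RtoC (2 * fst (szego q phi s) - 1)) with
    (szego q phi s + Cconj (szego q phi s) - 1)%C by (apply C_ext; simpl; ring).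
  ring. }
unfold two_peak_mode.
eapply has_mean_ext; [|apply has_mean_scal, has_mean_comb; apply H].
intros s. cbv beta. rewrite !two_peak_peaks by exact Hq. unfold peaks, polF.
match goal with |- _ = (RtoC ?a * _)%C => replace (RtoC a) with
  (RtoC m * (RtoC p * RtoC (2 * fst (szego q alpha s) - 1) +
             RtoC (1 - p) * RtoC (2 * fst (szego q beta s) - 1)))%C
  by (apply C_ext; simpl; ring) end.
ring.
Qed.

Lemma two_peak_coef (q m p alpha beta : R) (n : nat) : 0 <= q < 1 ->
  cos_coef (two_peak q m p alpha beta) (INR (S n)) =
    2 * PI * fst (two_peak_mode q m p alpha beta (S n)) /\
  sin_coef (two_peak q m p alpha beta) (INR (S n)) =
    2 * PI * snd (two_peak_mode q m p alpha beta (S n)).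
Proof.
intros Hq. destruct (two_peak_has_mode q m p alpha beta n Hq) as [A B].
split; apply is_RInt_unique.
- apply is_RInt_ext with (2 := A). intros s _. rewrite cis_pow. unfold cis. simpl. ring.
- apply is_RInt_ext with (2 := B). intros s _. rewrite cis_pow. unfold cis. simpl. ring.
Qed.

Lemma two_peak_mode_cis (q m p alpha beta s : R) (n : nat) :
  (Cconj (two_peak_mode q m p alpha beta n) * cis s ^ n)%C =
  (RtoC m * (RtoC p * wave q alpha s ^ n + RtoC (1 - p) * wave q beta s ^ n))%C.
Proof.
unfold two_peak_mode.
rewrite Cmult_conj, Cplus_conj, !Cmult_conj, !Cpow_conj, !Cmult_conj, !cis_conj, !Cconj_RtoC.
rewrite !wave_split, !Cpow_mult_l. ring.
Qed.

Lemma two_peak_Lambda (q m p alpha beta s : R) : 0 < q < 1 ->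
  Lambda (two_peak q m p alpha beta) s = 2 * m * fst (peaks q p alpha beta polG s).
Proof.
intros Hq. pose proof PI_RGT_0 as Hpi.
pose proof (two_peak_smooth q m p alpha beta ltac:(lra)) as Hsm.
rewrite Lambda_eq by (intros; now apply smooth_circle_continuous).
apply is_series_unique.
destruct (has_sum_comb _ _ p (1 - p) _ _ (proj1 (proj2 (wave_power_sums q alpha s Hq)))
  (proj1 (proj2 (wave_power_sums q beta s Hq)))) as [H _].
apply (is_series_scal (V := R_NormedModule) (2 * m)) in H.
eapply is_series_ext; [|exact H]. intros n. cbv beta.
change (scal (2 * m) ?x) with (2 * m * x).
unfold Lambda_term.
destruct (two_peak_coef q m p alpha beta n ltac:(lra)) as [-> ->].
pose proof (two_peak_mode_cis q m p alpha beta s (S n)) as E.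
rewrite cis_pow in E. apply (f_equal fst) in E.
set (v := two_peak_mode q m p alpha beta (S n)) in *.
set (N := INR (S n)) in *.
set (za := (wave q alpha s ^ S n)%C) in *. set (zb := (wave q beta s ^ S n)%C) in *.
clearbody v N za zb.
transitivity (2 * N * fst (Cconj v * cis (N * s))%C);
  [rewrite E; simpl; ring|].
unfold cis. simpl. field. lra.
Qed.

(** Differentiation multiplies the mode [n] by [i n], so the coefficients carry
    [n^2] and the sum is the third one in [wave_power_sums]. *)
Lemma two_peak_Lambda_derive (q m p alpha beta s : R) : 0 < q < 1 ->
  Lambda (Derive (two_peak q m p alpha beta)) s =
  - 2 * m * snd (peaks q p alpha beta polK s).
Proof.
intros Hq. pose proof PI_RGT_0 as Hpi.
pose proof (two_peak_smooth q m p alpha beta ltac:(lra)) as Hsm.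
pose proof (smooth_circle_Derive _ Hsm) as Hsm'.
rewrite Lambda_eq by (intros; now apply smooth_circle_continuous).
apply is_series_unique.
destruct (has_sum_comb _ _ p (1 - p) _ _ (proj2 (proj2 (wave_power_sums q alpha s Hq)))
  (proj2 (proj2 (wave_power_sums q beta s Hq)))) as [_ H].
apply (is_series_scal (V := R_NormedModule) (- 2 * m)) in H.
eapply is_series_ext; [|exact H]. intros n. cbv beta.
change (scal (- 2 * m) ?x) with (- 2 * m * x).
unfold Lambda_term.
destruct (coef_Derive _ (Z.of_nat (S n)) Hsm) as [A B].
rewrite <- INR_IZR_INZ in A, B. rewrite A, B.
destruct (two_peak_coef q m p alpha beta n ltac:(lra)) as [-> ->].
pose proof (two_peak_mode_cis q m p alpha beta s (S n)) as E.
rewrite cis_pow in E. apply (f_equal snd) in E.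
set (v := two_peak_mode q m p alpha beta (S n)) in *.
set (N := INR (S n)) in *.
set (za := (wave q alpha s ^ S n)%C) in *. set (zb := (wave q beta s ^ S n)%C) in *.
clearbody v N za zb.
transitivity (- 2 * N ^ 2 * snd (Cconj v * cis (N * s))%C);
  [rewrite E; simpl; ring|].
unfold cis. simpl. field. lra.
Qed.

(** * The cubic energy *)

(** With [rho = m Re F], [rho' = -2 m Im G] and the like, expanding the real and
    imaginary parts groups the integrand by the number of conjugated factors;
    up to conjugation at most one factor is conjugated. *)
Lemma two_peak_energy (q m p alpha beta : R) : 0 < q < 1 ->
  2 * I1 (two_peak q m p alpha beta) + I2 (two_peak q m p alpha beta) =
  4 * PI * m ^ 3 * fst (peak_sum p (fun a b c =>
      let phi (i : bool) := if i then alpha else beta in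
      cubic_kernel (kappa q (phi a) (phi c)) (kappa q (phi b) (phi c)))).
Proof.
intros Hq. assert (Hq' : 0 <= q < 1) by lra.
set (rho := two_peak q m p alpha beta).
pose proof (two_peak_smooth q m p alpha beta Hq') as Hsm. fold rho in Hsm.
pose proof (smooth_circle_Derive _ Hsm) as Hsm'.
assert (HI : is_RInt (fun s => 2 * (rho s * Lambda (Derive rho) s * Derive rho s)
    + 1 * (Lambda rho s * Derive rho s ^ 2)) 0 (2 * PI) (2 * I1 rho + 1 * I2 rho)).
{ apply is_RInt_comb2; apply (RInt_correct (V := R_CompleteNormedModule)).
  - apply (ex_RInt_mult_continuous (fun s => rho s * Lambda (Derive rho) s));
      intros s; [|now apply smooth_circle_continuous].
    apply (continuous_mult rho (Lambda (Derive rho)));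
      [now apply smooth_circle_continuous|now apply Lambda_continuous].
  - apply (ex_RInt_mult_continuous (Lambda rho)); intros s;
      [now apply Lambda_continuous|].
    apply (continuous_ext (fun t => Derive rho t * Derive rho t)); [intros; simpl; ring|].
    apply (continuous_mult (Derive rho) (Derive rho)); now apply smooth_circle_continuous. }
rewrite Rmult_1_l in HI. rewrite <- (is_RInt_unique _ _ _ _ HI).
apply is_RInt_unique.
set (F := peaks q p alpha beta polF). set (G := peaks q p alpha beta polG).
set (K := peaks q p alpha beta polK).
pose proof (has_mean_peaks q p alpha beta polF polG polK Hq') as M1.
pose proof (has_mean_peaks q p alpha beta polF polK polG Hq') as M2.
pose proof (has_mean_peaks q p alpha beta polG polK polF Hq') as M3.
pose proof (has_mean_peaks q p alpha beta polG polG polG Hq') as M4.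
pose proof (has_mean_holomorphic q p alpha beta polF polK Hq') as M5.
pose proof (has_mean_holomorphic q p alpha beta polG polG Hq') as M6.
pose proof (has_mean_minus _ _ _ _ (has_mean_minus _ _ _ _
  (has_mean_plus _ _ _ _
    (has_mean_minus _ _ _ _ (has_mean_plus _ _ _ _ M1 M2) M3) M4) M5) M6) as [M _].
clear M1 M2 M3 M4 M5 M6. fold F G K in M.
apply (is_RInt_scal (V := R_NormedModule) _ _ _ (2 * m ^ 3)) in M.
match type of M with is_RInt _ _ _ ?v => replace v with
  (4 * PI * m ^ 3 * fst (peak_sum p (fun a b c =>
      let phi (i : bool) := if i then alpha else beta in
      cubic_kernel (kappa q (phi a) (phi c)) (kappa q (phi b) (phi c))))) in M end.
- apply is_RInt_ext with (2 := M). intros s _.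
  unfold rho. rewrite two_peak_peaks, two_peak_derive, two_peak_Lambda,
    two_peak_Lambda_derive by lra.
  fold F G K. change (scal (2 * m ^ 3) ?x) with (2 * m ^ 3 * x).
  destruct (F s) as [f1 f2], (G s) as [g1 g2], (K s) as [k1 k2]. simpl. ring.
- change (scal (2 * m ^ 3) ?x) with (2 * m ^ 3 * x).
  replace (fst (peak_sum _ _)) with
    (fst ((peak_sum p (fun a b c =>
      let phi (i : bool) := if i then alpha else beta in
      triple_mean polF polG polK (kappa q (phi a) (phi c)) (kappa q (phi b) (phi c))) +
     peak_sum p (fun a b c =>
      let phi (i : bool) := if i then alpha else beta in
      triple_mean polF polK polG (kappa q (phi a) (phi c)) (kappa q (phi b) (phi c))) -
     peak_sum p (fun a b c =>
      let phi (i : bool) := if i then alpha else beta in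
      triple_mean polG polK polF (kappa q (phi a) (phi c)) (kappa q (phi b) (phi c))) +
     peak_sum p (fun a b c =>
      let phi (i : bool) := if i then alpha else beta in
      triple_mean polG polG polG (kappa q (phi a) (phi c)) (kappa q (phi b) (phi c))) - 0 - 0)%C)).
  { ring. }
  f_equal. unfold peak_sum. cbv zeta.
  rewrite <- !triple_mean_cubic_kernel. ring.
Qed.

Theorem theorem3p55 (q m p alpha beta : R)
  (hq0 : 0 < q) (hq1 : q < 1) (hm : 0 < m) (hp0 : 0 <= p) (hp1 : p <= 1) :
  (forall s, ex_series (fun n => q ^ S n * cos (INR (S n) * s)) /\
     poisson q s = 1 + 2 * Series (fun n => q ^ S n * cos (INR (S n) * s))) /\
  smooth_circle (two_peak q m p alpha beta) /\
  (forall s, 0 < two_peak q m p alpha beta s) /\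
  2 * I1 (two_peak q m p alpha beta) + I2 (two_peak q m p alpha beta) > 0.
Proof.
assert (Hq : 0 < q < 1) by lra.
split; [|split; [|split]].
- intros s. destruct (wave_power_sums q 0 s Hq) as [[H _] _].
  assert (HS : is_series (fun n => q ^ S n * cos (INR (S n) * s))
                 (fst (szego q 0 s - 1)%C)).
  { apply is_series_ext with (2 := H). intros n. unfold wave.
    rewrite Rminus_0_r, Cpow_mult_l, cis_pow, <- RtoC_pow. unfold cis. simpl. ring. }
  split; [eexists; exact HS|].
  rewrite (is_series_unique _ _ HS).
  pose proof (poisson_szego q 0 s ltac:(lra)) as E. rewrite Rminus_0_r in E.
  rewrite E. simpl. ring.
- apply two_peak_smooth; lra.
- intros s. pose proof (poisson_pos q (s - alpha) ltac:(lra)).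
  pose proof (poisson_pos q (s - beta) ltac:(lra)).
  unfold two_peak. apply Rmult_lt_0_compat; [exact hm|].
  destruct (Req_dec p 0) as [->|Hp]; [lra|].
  assert (0 < p * poisson q (s - alpha)) by (apply Rmult_lt_0_compat; lra).
  assert (0 <= (1 - p) * poisson q (s - beta)) by (apply Rmult_le_pos; lra).
  lra.
- rewrite two_peak_energy by exact Hq. pose proof PI_RGT_0.
  apply Rlt_gt, Rmult_lt_0_compat.
  + apply Rmult_lt_0_compat; [lra|now apply pow_lt].
  + apply peak_sum_cubic_kernel_pos; lra.
Qed.
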